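(* Let $\mathcal{N}$ be a near hexagon of order $(2,2)$ which contains a subgeometry isomorphic to the generalized hexagon $\mathrm{H}(2,1)$ that is isometrically embedded in $\mathcal{N}$. Then $\mathcal{N}$ is isomorphic to the dual split Cayley hexagon $\mathrm{H}(2)^D$.
   Context: A partial linear space has order $(s,t)$ if every line has exactly $s+1$ points and every point is on exactly $t+1$ lines. Distances are measured in the collinearity graph. A near $2d$-gon is a partial linear space whose collinearity graph is connected of diameter $d$ and such that for every point $x$ and every line $L$ there is a unique point on $L$ nearest to $x$; a near hexagon is a near $6$-gon. A subgeometry $\mathcal{S}=(\mathcal{P},\mathcal{L})$ of $\mathcal{N}=(\mathcal{P}',\mathcal{L}')$ (with $\mathcal{P}\subseteq\mathcal{P}'$, $\mathcal{L}\subseteq\mathcal{L}'$ and induced incidence) is isometrically embedded if distances between points of $\mathcal{P}$ in $\mathcal{S}$ and in $\mathcal{N}$ coincide. $\mathrm{H}(2,1)$ is the unique generalized hexagon of order $(2,1)$ (the point-line dual of the incidence graph of the Fano plane). $\mathrm{H}(2)^D$ is the point-line dual of the split Cayley hexagon $\mathrm{H}(2)$ of order $(2,2)$. *)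

(* Defs.v *)
From mathcomp Require Import all_boot all_order all_algebra.
From mathcomp Require Import boolp classical_sets functions cardinality.

Set Implicit Arguments.
Unset Strict Implicit.
Unset Printing Implicit Defensive.

Import GRing.Theory.
Local Open Scope classical_set_scope.
Local Open Scope card_scope.
Local Open Scope ring_scope.

Record geometry := Geometry {
  points : Type;
  lines : Type;
  inc : points -> lines -> Prop
}.

Definition dual (G : geometry) : geometry :=
  @Geometry (lines G) (points G) (fun l x => inc x l).

Definition isomorphic (G H : geometry) : Prop :=
  exists (f : points G -> points H) (g : lines G -> lines H),
    [/\ bijective f, bijective g & forall x l, inc x l <-> inc (f x) (g l)].

Definition partial_linear_space (G : geometry) : Prop :=
  forall (x y : points G) (k l : lines G), x <> y ->
    inc x k -> inc y k -> inc x l -> inc y l -> k = l.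

Definition has_order (G : geometry) (s t : nat) : Prop :=
  (forall l : lines G, [set x | inc x l] #= `I_s.+1) /\
  (forall x : points G, [set l | inc x l] #= `I_t.+1).

Definition collinear (G : geometry) (x y : points G) : Prop :=
  x <> y /\ exists l : lines G, inc x l /\ inc y l.

Fixpoint walk (G : geometry) (n : nat) (x y : points G) : Prop :=
  if n is m.+1 then exists2 z, collinear x z & walk m z y else x = y.

(* The distance as a functional relation; it has no value on points in
   different connected components. *)
Definition distance (G : geometry) (x y : points G) (n : nat) : Prop :=
  walk n x y /\ forall m, walk m x y -> (n <= m)%N.

Definition connected_of_diameter (G : geometry) (d : nat) : Prop :=
  (forall x y : points G, exists2 n, distance x y n & (n <= d)%N) /\
  (exists x y : points G, distance x y d).

Definition nearest (G : geometry) (x : points G) (l : lines G) (y : points G) :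
    Prop :=
  inc y l /\
  forall z m n, inc z l -> distance x y m -> distance x z n -> (m <= n)%N.

(* near_polygon d formalizes near 2d-gons, not near d-gons. *)
Definition near_polygon (d : nat) (G : geometry) : Prop :=
  [/\ partial_linear_space G, connected_of_diameter G d
    & forall (x : points G) (l : lines G), exists! y, nearest x l y].

Definition near_hexagon (G : geometry) : Prop := near_polygon 3 G.

Definition subgeometry (G : geometry) (A : set (points G)) (B : set (lines G)) :
    geometry :=
  @Geometry (set_type A) (set_type B) (fun x l => inc (val x) (val l)).

Definition isometrically_embedded (G : geometry) (A : set (points G))
    (B : set (lines G)) : Prop :=
  forall (x y : points (subgeometry A B)) (n : nat),
    distance x y n <-> distance (val x) (val y) n.

Definition projective_plane (F : fieldType) : geometry :=
  @Geometry (set_type [set U : {vspace 'rV[F]_3} | \dim U = 1%N])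
            (set_type [set U : {vspace 'rV[F]_3} | \dim U = 2%N])
            (fun p l => (val p <= val l)%VS).

Definition fano_plane : geometry := projective_plane 'F_2.

(* The incidence graph as a geometry whose lines are its edges; these are the
   flags of G. *)
Definition incidence_graph (G : geometry) : geometry :=
  @Geometry (points G + lines G)%type
            (set_type [set e : points G * lines G | inc e.1 e.2])
            (fun v e => v = inl (val e).1 \/ v = inr (val e).2).

Definition H21 : geometry := dual (incidence_graph fano_plane).

(* split_Cayley_hexagon F is the model of Tits: its points are all the points of
   the parabolic quadric X0 X4 + X1 X5 + X2 X6 = X3^2 of PG(6, F), and its lines
   are the lines on this quadric whose Grassmann coordinates p_ij satisfy
   tits_equations. The numerals below are elements of 'I_7. *)
Definition quadric (F : fieldType) (v : 'rV[F]_7) : Prop :=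
  v 0 0 * v 0 4 + v 0 1 * v 0 5 + v 0 2 * v 0 6 = v 0 3 ^+ 2.

Definition grassmann (F : fieldType) (u v : 'rV[F]_7) (i j : 'I_7) : F :=
  u 0 i * v 0 j - u 0 j * v 0 i.

(* The equations are homogeneous in the Grassmann coordinates, so that on a
   2-dimensional subspace they hold for every pair of vectors as soon as they
   hold for one basis. *)
Definition tits_equations (F : fieldType) (u v : 'rV[F]_7) : Prop :=
  let p := grassmann u v in
  [/\ p 1 2 = p 3 4, p 5 4 = p 3 2 & p 2 0 = p 3 5] /\
  [/\ p 6 5 = p 3 0, p 0 1 = p 3 6 & p 4 6 = p 3 1].

Definition split_Cayley_point (F : fieldType) (U : {vspace 'rV[F]_7}) : Prop :=
  \dim U = 1%N /\ {in U, forall v, quadric v}.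

Definition split_Cayley_line (F : fieldType) (U : {vspace 'rV[F]_7}) : Prop :=
  [/\ \dim U = 2%N, {in U, forall v, quadric v}
    & {in U &, forall u v, tits_equations u v}].

Definition split_Cayley_hexagon (F : fieldType) : geometry :=
  @Geometry (set_type [set U : {vspace 'rV[F]_7} | split_Cayley_point U])
            (set_type [set U : {vspace 'rV[F]_7} | split_Cayley_line U])
            (fun p l => (val p <= val l)%VS).

Definition H2 : geometry := split_Cayley_hexagon 'F_2.

Definition H2D : geometry := dual H2.

(* Main.v *)
(* A point x of N is described by its valuation, the function d(x, -) on the 21
   points of the embedded H = H(2,1). On every line of H a valuation has one
   smallest value and exceeds it by one at the other two points, and in the same
   way the valuations of two points on a line of N determine that of the third.
   Enumeration leaves for x outside H only valuations with 0, 1, 2, 4 or 7 ones.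
   Each point of H must be closer to some neighbour of x than to x, but the
   three lines on x provide just three pairs of neighbours; this covering
   condition excludes three or more ones, and forces all neighbours outside H of
   a point with two ones to have two ones as well. Hence if some neighbour of h
   outside H has a single one, then the points of H opposite to h also have such
   neighbours, and thus all points of H do. The alternative, that all neighbours
   of H have two ones, would group the 21 points of H in fours. Now the covering
   condition excludes the valuations without ones, and the remaining 21 + 42
   valuations are exactly those of the points of H(2)^D with respect to its own
   H(2,1); the neighbours that they require are those on the lines of H(2)^D. *)
Require Import Defs.
From HB Require Import structures.
From mathcomp Require Import all_boot all_order all_algebra.
From mathcomp Require Import boolp classical_sets functions cardinality.
From mathcomp Require Import zify.

Set Implicit Arguments.
Unset Strict Implicit.
Unset Printing Implicit Defensive.

Import GRing.Theory.

Notation at_ f i := (nth 0 f i).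

(** * Isomorphisms of geometries and graph distance *)

Lemma bijective_inj_surj (T U : Type) (f : T -> U) :
  injective f -> (forall y, exists x, f x = y) -> bijective f.
Proof.
move=> f_inj f_surj; have [g fgK] := choice f_surj.
by exists g => x //; apply: f_inj; rewrite fgK.
Qed.

Lemma isomorphic_sym (G H : geometry) : isomorphic G H -> isomorphic H G.
Proof.
case=> f [g [[f' fK f'K] [g' gK g'K] fg]]; exists f', g'.
split; [by exists f | by exists g | move=> x l].
by rewrite fg f'K g'K.
Qed.

Lemma isomorphic_trans (G H K : geometry) :
  isomorphic G H -> isomorphic H K -> isomorphic G K.
Proof.
case=> f [g [f_bij g_bij fg]] [f' [g' [f'_bij g'_bij fg']]].
exists (f' \o f), (g' \o g).
split; [exact: bij_comp | exact: bij_comp | by move=> x l; rewrite fg fg'].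
Qed.

Section IsomorphismDistance.

Variables (G H : geometry) (f : points G -> points H) (g : lines G -> lines H).
Hypotheses (f_bij : bijective f) (g_bij : bijective g).
Hypothesis fg : forall x l, inc x l <-> inc (f x) (g l).

Lemma collinear_iso x y : collinear (f x) (f y) <-> collinear x y.
Proof.
split=> -[ne_xy [l [xl yl]]]; split.
- by move=> eq_xy; apply: ne_xy; rewrite eq_xy.
- by case: g_bij xl yl => g' _ g'K; rewrite -(g'K l) -!fg; exists (g' l).
- by move=> /(bij_inj f_bij).
- by exists (g l); rewrite -!fg.
Qed.

Lemma walk_iso n x y : walk n (f x) (f y) <-> walk n x y.
Proof.
elim: n x => [|n IHn] x /=; first by split=> [/(bij_inj f_bij)|->].
split=> -[z xz zy].
- case: f_bij xz zy => f' _ f'K; rewrite -(f'K z) collinear_iso IHn.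
  by exists (f' z).
- by exists (f z); [rewrite collinear_iso | rewrite IHn].
Qed.

Lemma distance_iso x y n : distance (f x) (f y) n <-> distance x y n.
Proof.
rewrite /distance walk_iso; split=> -[xy min_n]; split=> // m.
- by move=> /walk_iso/min_n.
- by move=> /walk_iso/min_n.
Qed.

End IsomorphismDistance.

Lemma walk_cat (G : geometry) m n (x y z : points G) :
  walk m x y -> walk n y z -> walk (m + n) x z.
Proof.
elim: m x => [x -> //|m IHm] x [w xw wy] yz.
by exists w => //; apply: IHm.
Qed.

Lemma collinear_sym (G : geometry) (x y : points G) :
  collinear x y -> collinear y x.
Proof.
by case=> ne_xy [l [xl yl]]; split; [move=> /esym | exists l].
Qed.

Lemma walk_sym (G : geometry) n (x y : points G) : walk n x y -> walk n y x.
Proof.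
elim: n x => [x -> //|n IHn] x [z xz /IHn yz].
by rewrite -addn1; apply: walk_cat yz _; exists x => //; apply: collinear_sym.
Qed.

Lemma distance_unique (G : geometry) (x y : points G) m n :
  distance x y m -> distance x y n -> m = n.
Proof.
by move=> [xy_m min_m] [xy_n min_n]; apply/eqP; rewrite eqn_leq min_m ?min_n.
Qed.

(** * Linear algebra over the field with two elements *)

(** Vectors over F_2 become lists of bits, so that finite statements about them are decided by
    evaluation. The zero vector comes first, and dropping the head leaves the nonzero vectors. *)
Fixpoint bitvecs n : seq bitseq :=
  if n is m.+1 then [seq b :: s | b <- [:: false; true], s <- bitvecs m]
  else [:: [::]].

Definition nonzero n : seq bitseq := behead (bitvecs n).

Definition addbits (s t : bitseq) : bitseq := [seq x.1 (+) x.2 | x <- zip s t].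

Definition vec n (s : bitseq) : 'rV['F_2]_n :=
  (\row_i (nth false s i)%:R)%R.

Lemma mem_bitvecs n s : (s \in bitvecs n) = (size s == n).
Proof.
elim: n s => [|n IHn] [|b s] //.
- by apply/allpairsP=> -[[? ?] []].
- rewrite [RHS]eqSS -IHn; apply/allpairsP/idP =>
    [[[c t] /= [_ t_n [_ ->]]] //|s_n].
  by exists (b, s); split; rewrite // !inE; case: b.
Qed.

Lemma bitvecs_uniq n : uniq (bitvecs n).
Proof.
by elim: n => // n IHn; apply: allpairs_uniq => // -[b s] [c t] _ _ [-> ->].
Qed.

Lemma bitvecs_cons n : bitvecs n = nseq n false :: nonzero n.
Proof. by rewrite /nonzero; elim: n => //= n ->. Qed.

Lemma mem_nonzero n s :
  (s \in nonzero n) = (size s == n) && (s != nseq n false).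
Proof.
have := bitvecs_uniq n; rewrite -mem_bitvecs bitvecs_cons /= => /andP[n0 _].
by rewrite inE; case: eqP => [->|_]; rewrite ?andbF ?andbT //; apply: negbTE.
Qed.

Lemma F2_cases (k : 'F_2) : k = 0%R \/ k = 1%R.
Proof. by case: k => -[|[|//]] ?; [left | right]; apply: val_inj. Qed.

Lemma natr_F2_inj (b c : bool) : (b%:R = c%:R :> 'F_2)%R -> b = c.
Proof. by case: b; case: c. Qed.

Lemma natr_F2_add (b c : bool) : ((b (+) c)%:R = b%:R + c%:R :> 'F_2)%R.
Proof. by case: b; case: c; apply: val_inj. Qed.

Lemma natr_F2_mul (b c : bool) : ((b && c)%:R = b%:R * c%:R :> 'F_2)%R.
Proof. by case: b; case: c; apply: val_inj. Qed.

Lemma size_addbits n s t : size s = n -> size t = n -> size (addbits s t) = n.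
Proof. by move=> sn tn; rewrite size_map size_zip sn tn minnn. Qed.

Lemma vec0 n : vec n (nseq n false) = 0%R.
Proof. by apply/rowP=> i; rewrite !mxE nth_nseq if_same. Qed.

Lemma vec_inj n : {in bitvecs n &, injective (vec n)}.
Proof.
move=> s t; rewrite !mem_bitvecs => /eqP sn /eqP tn /rowP st.
apply: (@eq_from_nth _ false) => [|i]; rewrite sn // => lt_in.
by apply: natr_F2_inj; have := st (Ordinal lt_in); rewrite !mxE.
Qed.

Lemma vec_eq0 n s : s \in bitvecs n -> (vec n s == 0%R) = (s == nseq n false).
Proof.
move=> sn; apply/eqP/eqP=> [|->]; last exact: vec0.
by rewrite -vec0 => /vec_inj-> //; rewrite mem_bitvecs size_nseq.
Qed.

Lemma vec_add n s t : s \in bitvecs n -> t \in bitvecs n ->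
  vec n (addbits s t) = (vec n s + vec n t)%R.
Proof.
rewrite !mem_bitvecs => /eqP sn /eqP tn; apply/rowP=> i.
by rewrite !mxE (nth_map (false, false)) ?size_zip ?sn ?tn ?minnn //
           nth_zip ?sn // natr_F2_add.
Qed.

Lemma vec_surj n (v : 'rV['F_2]_n) : exists2 s, s \in bitvecs n & vec n s = v.
Proof.
exists [seq v ord0 i != 0%R | i <- enum 'I_n].
  by rewrite mem_bitvecs size_map size_enum_ord.
apply/rowP=> i; rewrite mxE (nth_map i) ?size_enum_ord // nth_ord_enum.
by case: (F2_cases (v ord0 i)) => ->.
Qed.

Lemma mem_vline_F2 n (v w : 'rV['F_2]_n) :
  (w \in <[v]>%VS) = (w \in [:: 0%R; v]).
Proof.
rewrite !inE; apply/vlineP/orP => [[k ->]|[] /eqP->].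
- by case: (F2_cases k) => ->; [left; rewrite scale0r | right; rewrite scale1r].
- by exists 0%R; rewrite scale0r.
- by exists 1%R; rewrite scale1r.
Qed.

Lemma mem_addv_vline_F2 n (u v w : 'rV['F_2]_n) :
  (w \in <[u]> + <[v]>)%VS = (w \in [:: 0; u; v; u + v]%R).
Proof.
apply/memv_addP/idP => [[x xu [y yv ->]]|].
  move: xu yv; rewrite !mem_vline_F2 !inE => /orP[]/eqP-> /orP[]/eqP->;
    by rewrite ?addr0 ?add0r !eqxx ?orbT.
have mem0 (z : 'rV['F_2]_n) : 0%R \in <[z]>%VS := mem0v _.
have memz (z : 'rV['F_2]_n) : z \in <[z]>%VS := memv_line z.
rewrite !inE => /or4P[] /eqP->.
- by exists 0%R => //; exists 0%R; rewrite ?addr0.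
- by exists u => //; exists 0%R; rewrite ?addr0.
- by exists 0%R => //; exists v; rewrite ?add0r.
- by exists u => //; exists v.
Qed.

(* A plane of F_2^n is represented by its three nonzero vectors. *)
Definition is_plane n (p : seq bitseq) : bool :=
  if p is [:: a; b; c] then
    [&& a \in nonzero n, b \in nonzero n, a != b & c == addbits a b]
  else false.

Definition span2 n (p : seq bitseq) : {vspace 'rV['F_2]_n} :=
  (<[vec n (nth [::] p 0)]> + <[vec n (nth [::] p 1)]>)%VS.

Lemma nonzero_bitvecs n : {subset nonzero n <= bitvecs n}.
Proof. by move=> s s_n; rewrite bitvecs_cons inE s_n orbT. Qed.

Lemma mem_span2 n p s : is_plane n p -> s \in bitvecs n ->
  (vec n s \in span2 n p) = (s \in nseq n false :: p).
Proof.
case: p => [|a [|b [|c [|//]]]] //= /and4P[/nonzero_bitvecs an] .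
move=> /nonzero_bitvecs bn ne_ab /eqP-> sn.
rewrite mem_addv_vline_F2 -vec_add // -vec0 !inE.
by rewrite !(inj_in_eq (@vec_inj n)) // ?mem_bitvecs ?size_nseq //
  (@size_addbits n) //; apply/eqP; rewrite -mem_bitvecs.
Qed.

Lemma dim_span2 n p : is_plane n p -> \dim (span2 n p) = 2.
Proof.
case: p => [|a [|b [|c [|//]]]] //= /and4P[an bn ne_ab _].
have vec_neq0 s : s \in nonzero n -> vec n s != 0%R.
  by move=> sn; rewrite vec_eq0 ?nonzero_bitvecs //; move: sn;
    rewrite mem_nonzero => /andP[].
rewrite dimv_disjoint_sum ?dim_vline ?vec_neq0 //.
apply/eqP; rewrite -subv0; apply/subvP=> v;
  rewrite memv_cap memv0 !mem_vline_F2.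
rewrite !inE => /andP[/orP[//|/eqP->]]; rewrite (negPf (vec_neq0 _ an)) /=.
by move=> /eqP/vec_inj ab; rewrite ab ?nonzero_bitvecs ?eqxx in ne_ab.
Qed.

Lemma span2_surj n (U : {vspace 'rV['F_2]_n}) :
  \dim U = 2 -> exists2 p, is_plane n p & U = span2 n p.
Proof.
move=> dimU; have U_neq0 : U != 0%VS by rewrite -dimv_eq0 dimU.
have [u_neq0 uU] : vpick U != 0%R /\ vpick U \in U by rewrite vpick0 memv_pick.
have /subvPn[v vU vu] : ~~ (U <= <[vpick U]>)%VS.
  by apply/negP=> /dimvS; rewrite dimU dim_vline u_neq0.
have [[a an au] [b bn bv]] := (vec_surj (vpick U), vec_surj v).
have ab : is_plane n [:: a; b; addbits a b].
  move: vu; rewrite mem_vline_F2 -bv -au -vec0 !inE negb_or => /andP[b0 ba].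
  rewrite /= eqxx andbT !mem_nonzero -!mem_bitvecs an bn -!vec_eq0 // au u_neq0.
  by rewrite -vec0 b0; apply: contraNN ba => /eqP->.
exists [:: a; b; addbits a b] => //; apply/eqP; rewrite eq_sym eqEdim.
rewrite dim_span2 // dimU leqnn andbT subv_add -!memvE /= au bv uU.
by rewrite vU.
Qed.

Lemma eq_span2 n p q : is_plane n p -> is_plane n q -> p =i q ->
  span2 n p = span2 n q.
Proof.
move=> p_n q_n pq; apply/vspaceP=> v; have [s s_n <-] := vec_surj v.
by rewrite !mem_span2 // !inE pq.
Qed.

Lemma vline_surj n (U : {vspace 'rV['F_2]_n}) :
  \dim U = 1 -> exists2 s, s \in nonzero n & U = <[vec n s]>%VS.
Proof.
move=> dimU; have U_neq0 : U != 0%VS by rewrite -dimv_eq0 dimU.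
have [u_neq0 uU] : vpick U != 0%R /\ vpick U \in U by rewrite vpick0 memv_pick.
have [s sn su] := vec_surj (vpick U).
exists s; first by rewrite mem_nonzero -mem_bitvecs sn -vec_eq0 // su.
by apply/eqP; rewrite eq_sym eqEdim -memvE su uU dimU dim_vline u_neq0.
Qed.

Lemma dim_vec n s : s \in nonzero n -> \dim <[vec n s]>%VS = 1.
Proof.
move=> sn; rewrite dim_vline vec_eq0 ?nonzero_bitvecs //.
by move: sn; rewrite mem_nonzero => /andP[_ ->].
Qed.

Lemma vline_vec_inj n s t : s \in nonzero n -> t \in nonzero n ->
  (<[vec n s]> = <[vec n t]>)%VS -> s = t.
Proof.
move=> sn tn st; have := memv_line (vec n s); rewrite st mem_vline_F2 !inE.
rewrite vec_eq0 ?nonzero_bitvecs //; move: (sn); rewrite mem_nonzero.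
move=> /andP[_ /negPf-> /eqP/vec_inj]; apply; exact: nonzero_bitvecs.
Qed.

Lemma vline_sub_span2 n p s : is_plane n p -> s \in nonzero n ->
  (<[vec n s]> <= span2 n p)%VS = (s \in p).
Proof.
move=> p_n sn; rewrite -memvE mem_span2 ?nonzero_bitvecs // inE.
by move: sn; rewrite mem_nonzero => /andP[_ /negPf->].
Qed.

(** Over F_2 squaring is the identity, so the right-hand side of the quadric is just the coordinate
    3; addition is exclusive or, and signs disappear. *)
Definition quadric7 (s : bitseq) : bool :=
  let v i := nth false s i in
  (v 0 && v 4) (+) (v 1 && v 5) (+) (v 2 && v 6) == v 3.

Definition tits7 (s t : bitseq) : bool :=
  let p i j := (nth false s i && nth false t j) (+)
               (nth false s j && nth false t i) in
  [&& p 1 2 == p 3 4, p 5 4 == p 3 2, p 2 0 == p 3 5,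
      p 6 5 == p 3 0, p 0 1 == p 3 6 & p 4 6 == p 3 1].

Lemma quadric_vec s : quadric (vec 7 s) <-> quadric7 s.
Proof.
rewrite /quadric !mxE expr2 -!natr_F2_mul -!natr_F2_add andbb.
split=> [/natr_F2_inj quad|/eqP quad]; first exact/eqP.
exact: (congr1 (fun b : bool => b%:R : 'F_2)%R quad).
Qed.

Lemma grassmann_vec s t (i j : 'I_7) :
  grassmann (vec 7 s) (vec 7 t) i j =
  ((nth false s i && nth false t j) (+) (nth false s j && nth false t i))%:R%R.
Proof.
rewrite /grassmann !mxE natr_F2_add !natr_F2_mul; congr (_ + _)%R.
have oppF (k : 'F_2) : (- k = k)%R by case: (F2_cases k) => ->; apply: val_inj.
exact: oppF.
Qed.

Lemma tits_vec s t : tits_equations (vec 7 s) (vec 7 t) <-> tits7 s t.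
Proof.
rewrite /tits_equations !grassmann_vec; split.
  case=> -[/natr_F2_inj p12 /natr_F2_inj p54 /natr_F2_inj p20].
  case=> /natr_F2_inj p65 /natr_F2_inj p01 /natr_F2_inj p46.
  by apply/and5P; split; last apply/andP; try split; apply/eqP.
case/and5P=> /eqP p12 /eqP p54 /eqP p20 /eqP p65 /andP[/eqP p01 /eqP p46].
have eqF (b c : bool) : b = c -> (b%:R = c%:R :> 'F_2)%R by move->.
by split; split; apply: eqF.
Qed.

(** * The hexagons on coordinates *)

Definition singular : seq bitseq := [seq s <- nonzero 7 | quadric7 s].

(* The Tits lines over F_2, each as the list of its points in the order of
   [singular], so that it occurs only once. *)
Definition tits_lines : seq (seq bitseq) :=
  [seq [:: p.1; p.2; addbits p.1 p.2] |
     p <- [seq (s, t) | s <- singular, t <- singular] &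
     [&& index p.1 singular < index p.2 singular,
         index p.2 singular < index (addbits p.1 p.2) singular,
         addbits p.1 p.2 \in singular & tits7 p.1 p.2]].

(** The duality is built in: the points are the 63 Tits lines and the lines are the 63 singular
    points. *)
Definition H2D_model : geometry :=
  @Geometry 'I_63 'I_63
    (fun i j => nth [::] singular j \in nth [::] tits_lines i).

Definition dot (s t : bitseq) : bool :=
  foldr addb false [seq x.1 && x.2 | x <- zip s t].

(** Every plane of F_2^3 is the orthogonal complement of a unique nonzero vector [b], so that
    nonzero vectors number the lines of the Fano plane as well as its points. *)
Definition fano_line (b : bitseq) : seq bitseq :=
  [seq a <- nonzero 3 | ~~ dot a b].

Definition flags : seq (bitseq * bitseq) :=
  [seq p <- [seq (a, b) | a <- nonzero 3, b <- nonzero 3] |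
     p.1 \in fano_line p.2].

Definition flag i : bitseq * bitseq := nth ([::], [::]) flags i.

(* The first seven lines are the points of the Fano plane. *)
Definition H21_lines : seq (seq nat) :=
  [seq [seq i <- iota 0 21 | (flag i).1 == a] | a <- nonzero 3] ++
  [seq [seq i <- iota 0 21 | (flag i).2 == b] | b <- nonzero 3].

Definition H21_model : geometry :=
  @Geometry 'I_21 'I_14 (fun i j => (i : nat) \in nth [::] H21_lines j).

Opaque nonzero.

(** The points of H(2,1) are the edges of the incidence graph, hence the 21 flags; its lines are the
    14 vertices, hence the points and lines of the Fano plane. *)
Lemma H21_model_iso : isomorphic H21_model H21.
Proof.
have flag_nz (i : 'I_21) :
    [/\ (flag i).1 \in nonzero 3, (flag i).2 \in nonzero 3
    & (flag i).1 \in fano_line (flag i).2].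
  have: flag i \in flags by apply: mem_nth.
  rewrite mem_filter => /andP[ab /allpairsP[[a b] [an bn eq_ab]]].
  by move: ab; rewrite eq_ab.
have line_plane b : b \in nonzero 3 -> is_plane 3 (fano_line b).
  have /allP chk : all (fun b => is_plane 3 (fano_line b)) (nonzero 3).
    by vm_compute.
  exact: chk.
have line_inj :
    {in nonzero 3 &, forall b c, fano_line b =i fano_line c -> b = c}.
  have /allP chk : all (fun b => all (fun c =>
      all [in fano_line c] (fano_line b) ==> (b == c)) (nonzero 3)) (nonzero 3).
    by vm_compute.
  move=> b c bn cn bc; have /implyP/(_ _)/eqP := allP (chk b bn) c cn.
  by apply; apply/allP=> s; rewrite /= bc.
have line_surj p : is_plane 3 p ->
    exists2 b, b \in nonzero 3 & fano_line b =i p.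
  case: p => [|a [|b [|c [|//]]]] //= /and4P[an bn ab /eqP->].
  have /allP chk : all (fun a => all (fun b => (a == b) || has (fun c =>
      perm_eq (fano_line c) [:: a; b; addbits a b]) (nonzero 3)) (nonzero 3))
      (nonzero 3).
    by vm_compute.
  have := allP (chk a an) b bn; rewrite (negPf ab) => /hasP[d dn /perm_mem].
  by exists d.
have mem_fano_line s b : s \in fano_line b -> s \in nonzero 3.
  by rewrite mem_filter => /andP[].
have sub_span s b : s \in nonzero 3 -> b \in nonzero 3 ->
    (<[vec 3 s]> <= span2 3 (fano_line b))%VS = (s \in fano_line b).
  by move=> sn /line_plane/vline_sub_span2; apply.
have span_inj b c : b \in nonzero 3 -> c \in nonzero 3 ->
    span2 3 (fano_line b) = span2 3 (fano_line c) -> b = c.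
  move=> bn cn bc; apply: line_inj => // s.
  have [sn|/negP s_notin] := boolP (s \in nonzero 3).
    by rewrite -(sub_span s b) // -(sub_span s c) // bc.
  by apply/idP/idP=> /mem_fano_line.
have span_surj (l : lines fano_plane) :
    exists2 b, b \in nonzero 3 & val l = span2 3 (fano_line b).
  have [p p_plane ->] := span2_surj (set_mem (valP l)).
  have [b bn bp] := line_surj p p_plane.
  by exists b => //; apply: eq_span2 => [||s]; rewrite ?bp ?line_plane.
have ptP a : a \in nonzero 3 ->
    exists p : points fano_plane, val p = <[vec 3 a]>%VS.
  by move=> an; exists (exist _ <[vec 3 a]>%VS (mem_set (dim_vec an))).
have lnP b : b \in nonzero 3 ->
    exists l : lines fano_plane, val l = span2 3 (fano_line b).
  move=> bn; have dim_b := dim_span2 (line_plane b bn).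
  by exists (exist _ (span2 3 (fano_line b)) (mem_set dim_b)).
have /choice[f fP] (i : 'I_21) : exists x : points H21,
    val (val x).1 = <[vec 3 (flag i).1]>%VS /\
    val (val x).2 = span2 3 (fano_line (flag i).2).
  have [an bn ab] := flag_nz i; have [[p pE] [l lE]] := (ptP _ an, lnP _ bn).
  have pl : inc (p, l).1 (p, l).2.
    by suff: (val p <= val l)%VS by []; rewrite pE lE sub_span.
  by exists (exist _ (p, l) (mem_set pl)).
have nth_nz j : j < 7 -> nth [::] (nonzero 3) j \in nonzero 3.
  by move=> lt_j7; apply: mem_nth.
have ge7 (j : 'I_14) : (j < 7) = false -> j - 7 < 7.
  by move=> /negbT; rewrite -leqNgt => ge_j7; rewrite ltn_subLR.
(* Indices below 7 give points of the Fano plane; the others, shifted by 7, give its lines. *)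
have /choice[g gP] (j : 'I_14) : exists l : lines H21,
    match l with
    | inl p => j < 7 /\ val p = <[vec 3 (nth [::] (nonzero 3) j)]>%VS
    | inr l => (j < 7) = false /\
        val l = span2 3 (fano_line (nth [::] (nonzero 3) (j - 7)))
    end.
  case lt_j7: (j < 7); first by have [p] := ptP _ (nth_nz j lt_j7);
    exists (inl p).
  by have [l] := lnP _ (nth_nz _ (ge7 j lt_j7)); exists (inr l).
have nz_uniq : uniq (nonzero 3) by vm_compute.
have nth_nz_inj i j : i < 7 -> j < 7 ->
    nth [::] (nonzero 3) i = nth [::] (nonzero 3) j -> i = j.
  by move=> i7 j7 /eqP; rewrite nth_uniq // => /eqP.
exists f, g; split.
- apply: bijective_inj_surj => [i j ij|x].
    have [[ia ib] [ja jb]] := (fP i, fP j).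
    have [[ian ibn _] [jan jbn _]] := (flag_nz i, flag_nz j).
    have eq_ij : flag i = flag j.
      rewrite [LHS]surjective_pairing [RHS]surjective_pairing; congr pair.
        by apply: (@vline_vec_inj 3) => //; rewrite -ia -ja ij.
      by apply: span_inj => //; rewrite -ib -jb ij.
    have flags_uniq : uniq flags by vm_compute.
    apply/val_inj; apply: (uniqP ([::], [::]) flags_uniq) eq_ij;
      exact: ltn_ord.
  have [a an aE] := vline_surj (set_mem (valP (val x).1)).
  have [b bn bE] := span_surj (val x).2.
  have := set_mem (valP x); rewrite /= [X in (X <= _)%VS]aE bE => ab.
  have {}ab : (a, b) \in flags.
    rewrite mem_filter /= -sub_span // ab.
    by apply/allpairsP; exists (a, b).
  have [i lt_i iE] := nthP ([::], [::]) ab.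
  exists (Ordinal (lt_i : i < 21)); have [] := fP (Ordinal (lt_i : i < 21)).
  have -> : flag (Ordinal (lt_i : i < 21)) = (a, b) by [].
  move=> fa fb; have {}fa := etrans fa (esym aE);
    have {}fb := etrans fb (esym bE).
  apply: val_inj; rewrite (surjective_pairing (val (f _))).
  rewrite (surjective_pairing (val x)); congr pair; exact: val_inj.
- apply: bijective_inj_surj => [i j ij|l].
    move: (gP i) (gP j); rewrite ij; case: (g j) => [p|l] [i7 iE] [j7 jE].
      apply/val_inj/nth_nz_inj => //; apply: (@vline_vec_inj 3);
        rewrite ?nth_nz //.
      exact: etrans (esym iE) jE.
    have eq_ij : i - 7 = j - 7.
      apply: nth_nz_inj; rewrite ?ge7 //; apply: span_inj;
        rewrite ?nth_nz ?ge7 //.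
      exact: etrans (esym iE) jE.
    by apply: val_inj => /=; move: i7 j7 eq_ij; clear; lia.
  case: l => [p|l].
    have [a an aE] := vline_surj (set_mem (valP p)).
    have [i lt_i7 iE] := nthP [::] an.
    have lt_i := leq_trans lt_i7 (isT : 7 <= 14).
    exists (Ordinal lt_i); have := gP (Ordinal lt_i).
    case: (g _) => [q [_ qE]|? [/negP[]//]].
    by congr inl; apply: val_inj; rewrite qE iE.
  have [b bn bE] := span_surj l.
  have [i lt_i7 iE] := nthP [::] bn.
  have lt_i : 7 + i < 14 by rewrite (ltn_add2l 7 _ 7).
  exists (Ordinal lt_i); have := gP (Ordinal lt_i).
  case: (g _) => [? [/=]|q [_ qE]]; first by rewrite ltnNge leq_addr.
  by congr inr; apply: val_inj; rewrite qE bE addKn iE.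
move=> i j; have i_iota : (i : nat) \in iota 0 21 by rewrite mem_iota ltn_ord.
have [[fa fb] [an bn _]] := (fP i, flag_nz i).
rewrite /= /H21_lines nth_cat size_map (_ : size (nonzero 3) = 7) //.
move: (gP j); case: (g j) => [p [j7 pE]|l [j7 lE]].
  rewrite j7 (nth_map [::]) // mem_filter i_iota andbT.
  split=> [/eqP aE|[|//]]; first by left; congr inl; apply: val_inj;
    rewrite pE fa aE.
  by case=> pE'; move: pE; rewrite pE' fa => /vline_vec_inj->; rewrite ?nth_nz.
rewrite j7 (nth_map [::]) ?ge7 // mem_filter i_iota andbT.
split=> [/eqP bE|[//|]]; first by right; congr inr; apply: val_inj;
  rewrite lE fb bE.
by case=> lE'; move: lE; rewrite lE' fb => /span_inj->; rewrite ?nth_nz ?ge7.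
Qed.

Lemma plane_nonzero n p : is_plane n p -> {subset p <= nonzero n}.
Proof.
case: p => [|a [|b [|c [|//]]]] //= /and4P[an bn ab /eqP->] s.
rewrite !inE => /or3P[] /eqP-> //.
have [a_n b_n] := (nonzero_bitvecs an, nonzero_bitvecs bn).
have c_n : addbits a b \in bitvecs n.
  by rewrite mem_bitvecs (@size_addbits n) //; apply/eqP; rewrite -mem_bitvecs.
rewrite mem_nonzero -mem_bitvecs c_n -vec_eq0 // vec_add //.
apply: contraNN ab => ab0; apply/eqP/(@vec_inj n) => //.
apply/eqP; rewrite -subr_eq0.
have -> // : (- vec n b = vec n b)%R.
by apply/rowP=> i; rewrite !mxE; case: (nth _ _ _); apply: val_inj.
Qed.

Lemma nth_ord_inj (T : eqType) (x0 : T) (s : seq T) n (i j : 'I_n) :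
  uniq s -> size s = n -> nth x0 s i = nth x0 s j -> i = j.
Proof.
move=> s_uniq sn ij; apply: val_inj.
by apply: (uniqP x0 s_uniq) ij; rewrite inE sn.
Qed.

Lemma singular_uniq : uniq singular. Proof. by vm_compute. Qed.

Lemma size_singular : size singular = 63. Proof. by vm_compute. Qed.

Lemma mem_singular s : (s \in singular) = (s \in nonzero 7) && quadric7 s.
Proof. by rewrite mem_filter andbC. Qed.

Lemma tits_lines_uniq : uniq tits_lines. Proof. by vm_compute. Qed.

Lemma size_tits_lines : size tits_lines = 63. Proof. by vm_compute. Qed.

Lemma tits_linesP p : p \in tits_lines -> [/\ is_plane 7 p,
  {subset p <= singular} & {in nseq 7 false :: p &, forall s t, tits7 s t}].
Proof.
have /allP chk : all (fun p => [&& is_plane 7 p, all [in singular] p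
    & all (fun s => all (tits7 s) (nseq 7 false :: p)) (nseq 7 false :: p)])
    tits_lines.
  by vm_compute.
move=> /chk/and3P[p_plane /allP p_sing /allP p_tits]; split=> // s t sp tp.
exact: (allP (p_tits s sp)).
Qed.

Lemma tits_lines_complete a b : a \in singular -> b \in singular ->
  addbits a b \in singular -> a != b -> tits7 a b ->
  exists2 p, p \in tits_lines & p =i [:: a; b; addbits a b].
Proof.
have /allP chk : all (fun a => all (fun b =>
    if [&& addbits a b \in singular, a != b & tits7 a b]
    then has (perm_eq [:: a; b; addbits a b]) tits_lines else true)
    singular) singular.
  by vm_compute.
move=> a_s b_s c_s ab tits_ab; have := allP (chk a a_s) b b_s.
rewrite c_s ab tits_ab => /hasP[p p_t /perm_mem pE].
by exists p => // s; rewrite pE.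
Qed.

Lemma tits_lines_inj : {in tits_lines &, forall p q, p =i q -> p = q}.
Proof.
have /allP chk : all (fun p => all (fun q => all [in q] p ==> (p == q))
    tits_lines) tits_lines.
  by vm_compute.
move=> p q p_t q_t pq; have /implyP/(_ _)/eqP := allP (chk p p_t) q q_t.
by apply; apply/allP=> s; rewrite /= pq.
Qed.

Opaque singular tits_lines.

Lemma split_Cayley_line_span2 p : p \in tits_lines ->
  split_Cayley_line (span2 7 p).
Proof.
move=> /tits_linesP[p_plane p_sing p_tits]; split; first exact: dim_span2.
- move=> v; have [s s7 <-] := vec_surj v; rewrite mem_span2 // inE quadric_vec.
  by move=> /predU1P[->|/p_sing]; [vm_compute | rewrite mem_singular =>
    /andP[]].
- move=> u v; have [[s s7 <-] [t t7 <-]] := (vec_surj u, vec_surj v).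
  rewrite (mem_span2 p_plane s7) (mem_span2 p_plane t7) tits_vec.
  exact: p_tits.
Qed.

(** Such a plane consists of zero and three singular vectors that satisfy the Tits equations
    pairwise, and the exhaustive list contains every such triple up to order. *)
Lemma split_Cayley_line_complete (U : {vspace 'rV['F_2]_7}) :
  split_Cayley_line U -> exists2 p, p \in tits_lines & U = span2 7 p.
Proof.
case=> /span2_surj[p p_plane ->] quadU titsU.
have p_nz := plane_nonzero p_plane.
have p_sing s : s \in p -> s \in singular.
  move=> sp; rewrite mem_singular p_nz // -quadric_vec; apply: quadU.
  by rewrite mem_span2 ?nonzero_bitvecs ?p_nz // inE sp orbT.
have p_tits s t : s \in p -> t \in p -> tits7 s t.
  move=> sp tp; rewrite -tits_vec; apply: titsU;
    by rewrite mem_span2 ?nonzero_bitvecs ?p_nz // inE ?sp ?tp orbT.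
case: p p_plane p_sing p_tits {quadU titsU p_nz} => [|a [|b [|c [|//]]]] //.
move=> p_plane p_sing p_tits; case/and4P: (p_plane) => an bn ab /eqP cE.
have [||||| q q_t qE] := @tits_lines_complete a b; rewrite -?cE ?p_sing //;
  rewrite ?p_tits ?inE ?eqxx ?orbT //.
exists q => //; apply: eq_span2; rewrite // ?cE //.
by have [] := tits_linesP q_t.
Qed.

Lemma split_Cayley_point_vec s : s \in singular ->
  split_Cayley_point <[vec 7 s]>%VS.
Proof.
rewrite mem_singular => /andP[s7 quad_s]; split; first exact: dim_vec.
move=> v; rewrite mem_vline_F2 -(vec0 7) !inE.
by move=> /orP[]/eqP->; rewrite quadric_vec.
Qed.

Lemma split_Cayley_point_complete (U : {vspace 'rV['F_2]_7}) :
  split_Cayley_point U -> exists2 s, s \in singular & U = <[vec 7 s]>%VS.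
Proof.
case=> /vline_surj[s s7 ->] quadU; exists s => //.
by rewrite mem_singular s7 -quadric_vec; apply/quadU/memv_line.
Qed.

Lemma H2D_model_iso : isomorphic H2D_model H2D.
Proof.
have line_in (i : 'I_63) : nth [::] tits_lines i \in tits_lines.
  by apply: mem_nth; rewrite size_tits_lines.
have sing_in (j : 'I_63) : nth [::] singular j \in singular.
  by apply: mem_nth; rewrite size_singular.
have /choice[f fP] (i : 'I_63) : exists x : points H2D,
    val x = span2 7 (nth [::] tits_lines i).
  by exists (exist _ (span2 7 _) (mem_set (split_Cayley_line_span2 (line_in
    i)))).
have /choice[g gP] (j : 'I_63) : exists l : lines H2D,
    val l = <[vec 7 (nth [::] singular j)]>%VS.
  by exists (exist _ <[vec 7 _]>%VS (mem_set (split_Cayley_point_vec (sing_in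
    j)))).
have nz s : s \in singular -> s \in nonzero 7.
  by rewrite mem_singular => /andP[].
have incP (i j : 'I_63) : (val (g j) <= val (f i))%VS =
    (nth [::] singular j \in nth [::] tits_lines i).
  have [i_plane _ _] := tits_linesP (line_in i).
  by rewrite fP gP (vline_sub_span2 i_plane) // nz.
exists f, g; split; last by move=> i j; rewrite /= -incP.
- apply: bijective_inj_surj => [i j ij|x].
    apply: (nth_ord_inj tits_lines_uniq size_tits_lines).
    have [i_plane i_sing _] := tits_linesP (line_in i).
    have [j_plane j_sing _] := tits_linesP (line_in j).
    apply: (tits_lines_inj (line_in i) (line_in j)) => s;
      have [s7|s7] := boolP (s \in nonzero 7).
      have := vline_sub_span2 j_plane s7; rewrite -fP -ij fP.
      by rewrite (vline_sub_span2 i_plane s7).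
    by apply/idP/idP=> [/i_sing|/j_sing] /nz; rewrite (negPf s7).
  have [p p_t pE] := split_Cayley_line_complete (set_mem (valP x)).
  have [i] := nthP [::] p_t; rewrite size_tits_lines => i63 iE.
  by exists (Ordinal i63); apply: val_inj; rewrite fP pE iE.
- apply: bijective_inj_surj => [i j ij|l].
    apply: (nth_ord_inj singular_uniq size_singular).
    apply: (@vline_vec_inj 7); [exact/nz/sing_in | exact/nz/sing_in |].
    exact: etrans (etrans (esym (gP i)) (congr1 val ij)) (gP j).
  have [s s_s sE] := split_Cayley_point_complete (set_mem (valP l)).
  have [i] := nthP [::] s_s; rewrite size_singular => i63 iE.
  by exists (Ordinal i63); apply: val_inj; rewrite gP sE iE.
Qed.

(** * Valuations of H(2,1) *)

(** Flags (a, b) and (c, d) are collinear when they share a point or a line. A common neighbour of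
    noncollinear flags is (a, d) or (c, b), which requires a on d or c on b; all remaining pairs are
    opposite. *)
Definition H21_dist i j : nat :=
  let: (a, b) := flag i in let: (c, d) := flag j in
  if (a == c) && (b == d) then 0
  else if (a == c) || (b == d) then 1
  else if (a \in fano_line d) || (c \in fano_line b) then 2 else 3.

Definition H21_row i : seq nat := [seq H21_dist i j | j <- iota 0 21].

Definition H21_row_list : seq (seq nat) := [seq H21_row i | i <- iota 0 21].

(* Locked, like [valuations], because conversion would enumerate it. *)
HB.lock Definition H21_rows : seq (seq nat) := H21_row_list.

Definition nearest_on_line a b c : bool :=
  [|| (b == a.+1) && (c == a.+1), (a == b.+1) && (c == b.+1)
    | (a == c.+1) && (b == c.+1)].

(* The conditions on a new last entry, in position [n]. *)
Definition extends_valuation n (f l : seq nat) : bool :=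
  if l is [:: i; j; k] then
    if k == n then nearest_on_line (at_ f i) (at_ f j) (at_ f k)
    else if j == n then (at_ f i <= (at_ f j).+1) && (at_ f j <= (at_ f i).+1)
    else true
  else false.

(** Backtracking over the positions, with each line tested as soon as its points are reached, keeps
    the enumeration small. The entries are 1, 2 or 3 because a point outside H(2,1) has positive
    distance, at most the diameter, to its points. *)
Fixpoint partial_valuations n : seq (seq nat) :=
  if n is m.+1 then
    [seq f <- [seq rcons f a | f <- partial_valuations m, a <- [:: 1; 2; 3]] |
       all (extends_valuation m f) H21_lines]
  else [:: [::]].

Definition valuation_list : seq (seq nat) := partial_valuations 21.

(* The candidates for the distances to the points of H(2,1) from a point outside
   it. *)
HB.lock Definition valuations : seq (seq nat) := valuation_list.

Definition valuations_of (P : pred nat) : seq (seq nat) :=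
  [seq f <- valuations | P (count_mem 1 f)].

(* On a line of a near polygon, two distances determine the third. *)
Definition third_val a b : nat := if a == b then a.-1 else maxn a b.

Definition third (f g : seq nat) : seq nat :=
  [seq third_val x.1 x.2 | x <- zip f g].

Definition on_line (f g : seq nat) : bool :=
  all2 (fun a b => nearest_on_line a b (third_val a b)) f g.

(** The candidates, in both orders, for the valuations of the other two points of a line on a point
    with valuation [f]. A conditional replaces the conjunction so that evaluation skips the second
    test when the first one fails. *)
Definition partners (V : seq (seq nat)) (f : seq nat) :=
  [seq (g, third f g) |
     g <- V & if on_line f g then third f g \in V else false].

Definition uncovered (f : seq nat) (p : seq nat * seq nat) (s : seq nat) :=
  [seq i <- s | (at_ f i <= at_ p.1 i) && (at_ f i <= at_ p.2 i)].

(* Whether the positions in [s] can be covered by at most [n] of the pairs in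
   [ps]; a pair covers the positions where one of its members is closer than
   [f]. *)
Fixpoint coverable (ps : seq (seq nat * seq nat)) n (f s : seq nat) : bool :=
  if s is i :: _ then
    if n is m.+1 then
      has (fun p => if at_ p.1 i < at_ f i
                    then coverable ps m f (uncovered f p s) else false) ps
    else false
  else true.

Definition coverable_by V n f s := coverable (partners V f) n f s.

(* The digits are the numbers of ones that are still possible for the valuation
   of a point outside H(2,1). *)
Definition V012 := H21_rows ++ valuations_of (gtn 3).
Definition V01 := H21_rows ++ valuations_of (gtn 2).
Definition V1 := H21_rows ++ valuations_of (pred1 1).

(** * Correctness of the enumeration and of the covering search *)

Lemma nearest_third a b c : nearest_on_line a b c -> c = third_val a b.
Proof.
rewrite /nearest_on_line /third_val; case: (a =P b) => [->|].
  by move=> /or3P[] /andP[/eqP ? /eqP ?]; lia.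
by move=> ? /or3P[] /andP[/eqP ? /eqP ?]; lia.
Qed.

Lemma mem_uncovered f p s i : (i \in uncovered f p s) =
  [&& at_ f i <= at_ p.1 i, at_ f i <= at_ p.2 i & i \in s].
Proof. by rewrite mem_filter andbA. Qed.

Lemma coverable_step ps n f s p (i := head 0 s) :
  p \in ps -> at_ p.1 i < at_ f i -> coverable ps n f (uncovered f p s) ->
  coverable ps n.+1 f s.
Proof.
by case: s @i => //= i s p_ps p_i p_s; apply/hasP; exists p; rewrite ?p_i.
Qed.

(** The search branches on the first uncovered position, which some pair of any given cover must
    cover; that pair is removed and the rest still covers what remains. The search inspects only the
    first member of a pair at this position, hence the requirement that both orders belong to
    [ps]. *)
Lemma coverable_complete ps (qs : seq (seq nat * seq nat)) n f s :
  size qs <= n ->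
  (forall q, q \in qs -> q \in ps /\ (q.2, q.1) \in ps) ->
  (forall i, i \in s -> exists2 q, q \in qs &
     (at_ q.1 i < at_ f i) || (at_ q.2 i < at_ f i)) ->
  coverable ps n f s.
Proof.
elim: n qs s => [|n IHn] qs [|i s] //= sz_qs qs_ps qs_s.
  have [q] := qs_s i (mem_head _ _).
  by move: sz_qs; rewrite leqn0 => /nilP->.
have [q q_qs q_i] := qs_s i (mem_head _ _).
have [r [r_ps r_i rE]] : exists r, [/\ r \in ps, at_ r.1 i < at_ f i
    & uncovered f r (i :: s) = uncovered f q (i :: s)].
  have [q_ps q'_ps] := qs_ps q q_qs.
  case/orP: q_i => q_i; [by exists q | exists (q.2, q.1); split=> //].
  by apply: eq_filter => j; rewrite andbC.
apply: (@coverable_step _ _ _ (i :: s) _ r_ps r_i); apply: (IHn (rem q qs)).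
- by rewrite size_rem // -ltnS prednK //; case: (qs) q_qs.
- by move=> p /mem_rem; apply: qs_ps.
- move=> j; rewrite rE mem_uncovered.
  move=> /and3P[j1 j2 /qs_s[p p_qs p_j]].
  exists p => //; have := perm_mem (perm_to_rem q_qs) p.
  rewrite p_qs inE; case: eqP => // pq; rewrite pq in p_j.
  by move: p_j; rewrite !ltnNge j1 j2.
Qed.

Lemma on_line_map (T : Type) (f g h : T -> nat) s :
  (forall x, nearest_on_line (f x) (g x) (h x)) ->
  on_line (map f s) (map g s) /\ third (map f s) (map g s) = map h s.
Proof.
move=> fgh; elim: s => [|x s [IH1 IH2]] //.
rewrite /on_line /third /= -(nearest_third (fgh x)) fgh.
by split; rewrite ?IH1 // -IH2.
Qed.

Lemma H21_lines_sorted l : l \in H21_lines ->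
  exists i j k, [/\ l = [:: i; j; k], i < j, j < k & k < 21].
Proof.
have /allP chk : all (fun l => if l is [:: i; j; k]
    then [&& i < j, j < k & k < 21] else false) H21_lines by vm_compute.
move=> /chk; case: l => [|i [|j [|k [|]]]] // /and3P[ij jk k21].
by exists i, j, k.
Qed.

(** By induction on its length, each prefix of [f] survives the pruning, because the tests on a
    prefix follow from the condition on whole lines. *)
Lemma valuations_complete f : size f = 21 -> all [in [:: 1; 2; 3]] f ->
  (forall i j k, [:: i; j; k] \in H21_lines ->
     nearest_on_line (at_ f i) (at_ f j) (at_ f k)) ->
  f \in valuations.
Proof.
move=> sz_f /allP f123 f_line; rewrite -[f]take_size sz_f valuations.unlock
  /valuation_list.
have: 21 <= size f by rewrite sz_f.
elim: 21 => [|n IHn] lt_nf; first by rewrite take0 inE.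
rewrite /= mem_filter (take_nth 0) //; apply/andP; split; last first.
  exact: allpairs_f (IHn (ltnW lt_nf)) (f123 _ (mem_nth 0 lt_nf)).
apply/allP=> l l_line; have [i [j [k [lE ij jk k21]]]] := H21_lines_sorted
  l_line.
rewrite lE in l_line *; rewrite -take_nth //=.
have nth_takeS m : m <= n -> at_ (take n.+1 f) m = at_ f m.
  by move=> le_mn; rewrite nth_take.
have := f_line _ _ _ l_line; case: eqP => [kn|_].
  by rewrite !nth_takeS //; lia.
(* With only two points of the line in the prefix, what is left of the condition is that their
   values differ by at most one. *)
case: eqP => // jn; rewrite !nth_takeS; [|lia..].
by rewrite /nearest_on_line; lia.
Qed.

Opaque flag H21_dist H21_row H21_lines third on_line partners uncovered
  coverable.

(** * Consequences of the covering condition, found by enumeration *)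

Lemma mem_valuations_of P f :
  (f \in valuations_of P) = P (count_mem 1 f) && (f \in valuations).
Proof. exact: mem_filter. Qed.

(** Nothing is known yet about the other points, so a neighbour may have any valuation; even then no
    three pairs cover all 21 positions. *)
Lemma not_coverable_ge3 f : f \in valuations_of (leq 3) ->
  coverable_by (H21_rows ++ valuations) 3 f (iota 0 21) -> False.
Proof.
have: let V := H21_rows ++ valuations in
    all (fun f => ~~ coverable_by V 3 f (iota 0 21)) (valuations_of (leq 3)).
  by rewrite /valuations_of valuations.unlock H21_rows.unlock; vm_compute.
by cbv zeta => /allP chk /chk/negP.
Qed.

Definition pair_uncoverable (V W : seq (seq nat)) f : bool :=
  let ps := partners V f in
  all (fun p => if p.1 \in W
    then ~~ coverable ps 2 f (uncovered f p (iota 0 21)) else true) ps.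

(** One of the three lines is spent on a neighbour with fewer than two ones, and two further lines
    never cover what it leaves. *)
Lemma not_coverable_pair f p : f \in valuations_of (pred1 2) ->
  p \in partners V012 f -> p.1 \in valuations_of (gtn 2) ->
  coverable (partners V012 f) 2 f (uncovered f p (iota 0 21)) -> False.
Proof.
have /allP chk : all (pair_uncoverable V012 (valuations_of (gtn 2)))
    (valuations_of (pred1 2)).
  by rewrite /V012 /valuations_of valuations.unlock H21_rows.unlock; vm_compute.
move=> /chk/allP chk_f /chk_f + p1.
by rewrite p1 => /negP.
Qed.

Lemma not_coverable_0 f : f \in valuations_of (pred1 0) ->
  coverable_by V01 3 f (iota 0 21) -> False.
Proof.
have: let V := V01 in
    all (fun f => ~~ coverable_by V 3 f (iota 0 21)) (valuations_of (pred1 0)).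
  by rewrite /V01 /valuations_of valuations.unlock H21_rows.unlock; vm_compute.
by cbv zeta => /allP chk /chk/negP.
Qed.

(** The position [i] of the one is a point h of H(2,1), and [g] belongs to the third point of the
    line joining h to a point with valuation [f]. A point opposite to h is at distance 3 from h, so
    it must be at distance 2 from one of the other two points of that line. *)
Lemma one_third f (i := index 1 f) (g := third f (H21_row i)) :
  f \in valuations_of (pred1 1) ->
  [/\ f <> g, g \in valuations_of (pred1 1), index 1 g = i
    & forall j, j < 21 -> H21_dist i j = 3 -> at_ f j = 2 \/ at_ g j = 2].
Proof.
have: let V := valuations_of (pred1 1) in all (fun f =>
    let i := index 1 f in let g := third f (H21_row i) in
    [&& f != g, g \in V, index 1 g == i
      & all (fun j => (H21_dist i j == 3) ==>
          ((at_ f j == 2) || (at_ g j == 2)))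
          (iota 0 21)]) V.
  by rewrite /valuations_of valuations.unlock; vm_compute.
cbv zeta => /allP chk /chk/and4P[/eqP fg g1 /eqP gi /allP opp];
  split=> // j j21 ij.
have := opp j; rewrite mem_iota -/i ij => /(_ j21).
by move=> /orP[]/eqP; [left | right].
Qed.

(** Each position thus carries at most two valuations with a single one, to be taken by the two
    outer points of the exterior line there. *)
Lemma one_unique f g : f \in valuations_of (pred1 1) ->
  g \in valuations_of (pred1 1) -> index 1 g = index 1 f ->
  g = f \/ g = third f (H21_row (index 1 f)).
Proof.
have: let V := valuations_of (pred1 1) in all (fun f => all (fun g =>
    [|| index 1 g != index 1 f, g == f | g == third f (H21_row (index 1 f))])
    V) V.
  by rewrite /valuations_of valuations.unlock; vm_compute.
cbv zeta => /allP chk /chk/allP chk_f /chk_f /or3P[/eqP fg /fg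
  //|/eqP->|/eqP->] _.
  by left.
by right.
Qed.

Lemma one_index f : f \in valuations_of (pred1 1) -> index 1 f < 21.
Proof.
have /allP chk : all (fun f => index 1 f < 21) (valuations_of (pred1 1)).
  by rewrite /valuations_of valuations.unlock; vm_compute.
exact: chk.
Qed.

(** Spreads the existence of neighbours with a single one from one point of H(2,1) to all others, in
    two passages to an opposite point. *)
Lemma opposite_connected i j : i < 21 -> j < 21 ->
  exists k, [/\ k < 21, H21_dist i k = 3 & H21_dist k j = 3].
Proof.
have /allP chk : all (fun i => all (fun j => has (fun k =>
    (H21_dist i k == 3) && (H21_dist k j == 3))
    (iota 0 21)) (iota 0 21)) (iota 0 21).
  by vm_compute.
move=> i21 j21; have := chk i; rewrite mem_iota => /(_ i21)/allP/(_ j).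
rewrite mem_iota => /(_ j21)/hasP[k];
  rewrite mem_iota => k21 /andP[/eqP ik /eqP kj].
by exists k.
Qed.

(* For a valuation with two ones, the ones are noncollinear points of H(2,1)
   and the center is their unique common neighbour. *)
Definition center (f : seq nat) : nat :=
  find (fun k => all (fun i => if at_ f i == 1 then H21_dist k i == 1 else true)
    (iota 0 21)) (iota 0 21).

Opaque center.

Definition center_neighbours f : bool :=
  let k := center f in
  (k < 21) && all (fun j => (H21_dist k j == 1) == ((at_ f j == 1) ||
      has (fun i => if at_ f i == 1 then at_ (third f (H21_row i)) j == 1
        else false) (iota 0 21))) (iota 0 21).

(** The four neighbours of the center are accounted for by the ones of [f] and the ones of the
    valuations that complete the exterior lines at these. Points of H(2,1) can therefore be grouped
    in fours by their centers. *)
Lemma center_two f (k := center f) : f \in valuations_of (pred1 2) -> k < 21 /\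
  forall j, j < 21 -> (H21_dist k j = 1 <-> at_ f j = 1 \/
    exists i, [/\ i < 21, at_ f i = 1 & at_ (third f (H21_row i)) j = 1]).
Proof.
have /allP chk : all center_neighbours (valuations_of (pred1 2)).
  by rewrite /valuations_of valuations.unlock; vm_compute.
move=> /chk/andP[k21 /allP chk_f]; split=> // j j21.
have := chk_f j; rewrite mem_iota => /(_ j21)/eqP; rewrite -/k => kj.
split=> [/eqP|ij]; last apply/eqP; rewrite kj.
  case/orP=> [/eqP|/hasP[i]]; first by left.
  by rewrite mem_iota => i21; case: eqP => // fi /eqP gj; right; exists i.
case: ij => [->|[i [i21 fi gj]]]; first by rewrite eqxx.
by apply/orP; right; apply/hasP; exists i; rewrite ?mem_iota // fi gj !eqxx.
Qed.

Lemma center_third f i (g := third f (H21_row i)) :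
  f \in valuations_of (pred1 2) -> i < 21 -> at_ f i = 1 ->
  [/\ g \in valuations_of (pred1 2), at_ g i = 1 & center g = center f].
Proof.
have: let V := valuations_of (pred1 2) in all (fun f => all (fun i =>
    let g := third f (H21_row i) in
    if at_ f i == 1 then [&& g \in V, at_ g i == 1 & center g == center f]
    else true) (iota 0 21)) V.
  by rewrite /valuations_of valuations.unlock; vm_compute.
cbv zeta => /allP chk /chk/allP/(_ i); rewrite mem_iota => chk_f /chk_f + fi.
by rewrite fi eqxx => /and3P[? /eqP ? /eqP ?].
Qed.

Lemma H21_degree k :
  k < 21 -> count (fun i => H21_dist k i == 1) (iota 0 21) = 4.
Proof.
have /allP chk : all (fun k =>
    count (fun i => H21_dist k i == 1) (iota 0 21) == 4)
    (iota 0 21).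
  by vm_compute.
by move=> k21; apply/eqP/chk; rewrite mem_iota.
Qed.

(** * The valuations of H(2)^D with respect to its H(2,1) *)

Definition collinear_tits (p q : seq bitseq) : bool := has [in p] q.

(** Collinearity in H(2)^D is concurrency of Tits lines. [collinear_tits] also relates a line to
    itself, hence the order of the tests. *)
Definition tits_dist (p q : seq bitseq) : nat :=
  if all [in p] q then 0 else if collinear_tits p q then 1
  else if has (fun r => collinear_tits p r && collinear_tits r q) tits_lines
  then 2 else 3.

(* The embedding of H(2,1) in the dual of H(2): the flag (a, b) of the Fano
   plane is sent to the line joining (a, 0, 0) and (0, 0, b). *)
Definition flag_line i : seq bitseq :=
  let: (a, b) := flag i in
  [:: a ++ nseq 4 false; nseq 4 false ++ b; a ++ false :: b].

Definition tits_row p : seq nat :=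
  [seq tits_dist p (flag_line i) | i <- iota 0 21].

Definition tits_rows : seq (seq nat) := [seq tits_row p | p <- tits_lines].

Opaque tits_row.

(** The link between the enumeration and H(2)^D: its points are told apart by their valuations, and
    these are precisely the candidates left at the end. *)
Lemma tits_rows_uniq_eq : uniq tits_rows /\ tits_rows =i V1.
Proof.
have /andP[uniq_rows /perm_mem rowsE] : uniq tits_rows && perm_eq tits_rows V1.
  by rewrite /V1 /valuations_of valuations.unlock H21_rows.unlock; vm_compute.
exact: conj uniq_rows rowsE.
Qed.

Lemma map_uniq_inj (T U : eqType) (f : T -> U) s :
  uniq (map f s) -> {in s &, injective f}.
Proof.
elim: s => //= a s IHs /andP[fa /IHs f_inj] x y; rewrite !inE.
move=> /predU1P[->|xs] /predU1P[->|ys] // fxy; last exact: f_inj.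
- by rewrite fxy map_f in fa.
- by rewrite -fxy map_f in fa.
Qed.

Lemma tits_row_inj : {in tits_lines &, injective tits_row}.
Proof. by have [/map_uniq_inj] := tits_rows_uniq_eq. Qed.

Lemma tits_line_points p : p \in tits_lines ->
  exists a b c, [/\ p = [:: a; b; c], a <> b, a <> c & b <> c].
Proof.
have /allP chk : all (fun p => (size p == 3) && uniq p) tits_lines.
  by vm_compute.
move=> /chk; case: p => [|a [|b [|c [|]]]] //=; rewrite !inE negb_or andbT.
by move=> /andP[/andP[/eqP ab /eqP ac] /eqP bc]; exists a, b, c.
Qed.

(** For a valuation in [V1] the minimum is 0 on H(2,1) and 1 outside, attained at one position
    only. *)
Definition min_index (g : seq nat) : nat :=
  if 0 \in g then index 0 g else index 1 g.

(* A line on a point with valuation [f] that gets closer to a position where [g]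
   is smallest can only have the valuations [f], [g] and [h]. *)
Definition forced V (f g h : seq nat) : bool :=
  let i := min_index g in
  [&& i < 21, 0 < at_ f i
    & all (fun g' => if at_ g' i < at_ f i then
        if on_line f g' then
          if third f g' \in V then
            (g' == g) && (third f g' == h) || (g' == h) && (third f g' == g)
          else true else true else true) V].

Definition pencil v : seq (seq bitseq) := [seq p <- tits_lines | v \in p].

(** Seen from one of its points, a line of H(2)^D is the only admissible line that gets closer to a
    suitable point of H(2,1), so N must contain a copy of it. Which point works depends on the line,
    hence the three arrangements tried. *)
Lemma pencil_forced v : v \in singular ->
  exists f g h,
    [seq tits_row p | p <- pencil v] =i [:: f; g; h] /\ forced V1 f g h.
Proof.
have: let V := V1 in all (fun v =>
    if [seq tits_row p | p <- pencil v] is [:: f; g; h]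
    then [|| forced V f g h, forced V g f h |
      forced V h f g] else false) singular.
  by rewrite /V1 /valuations_of valuations.unlock H21_rows.unlock; vm_compute.
cbv zeta => /allP chk /chk; case: [seq _ | _ <- _] => [|f [|g [|h [|p s]]]] //.
move=> /or3P[] fgh; [exists f, g, h | exists g, f, h | exists h, f, g];
  split=> // x;
  by rewrite !inE; do !case: eqP.
Qed.

Lemma pencil_inj : {in singular &, injective pencil}.
Proof.
have /allP chk : all (fun v => all (fun w =>
  (pencil v == pencil w) ==> (v == w))
    singular) singular.
  by vm_compute.
move=> v w v_s w_s vw; have := allP (chk v v_s) w w_s.
by rewrite vw eqxx => /eqP.
Qed.

(** * The distances of H(2,1) on coordinates *)

Lemma H21_dist_eq0 i j : i < 21 -> j < 21 -> H21_dist i j = 0 -> i = j.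
Proof.
have /allP chk : all (fun i => all (fun j => (H21_dist i j == 0) ==> (i == j))
    (iota 0 21)) (iota 0 21) by vm_compute.
move=> i21 j21 ij; apply/eqP; move: (chk i); rewrite mem_iota => /(_ i21).
by move=> /allP/(_ j); rewrite mem_iota ij => /(_ j21).
Qed.

Lemma size_H21_lines : size H21_lines = 14. Proof. by vm_compute. Qed.

Lemma H21_model_collinear (i j : points H21_model) :
  collinear i j <-> H21_dist i j = 1.
Proof.
have /allP chk : all (fun i => all (fun j => (H21_dist i j == 1) ==
    (i != j) && has (fun l => (i \in l) && (j \in l)) H21_lines)
    (iota 0 21)) (iota 0 21).
  by vm_compute.
have := chk i; rewrite mem_iota => /(_ (ltn_ord i))/allP/(_ j).
rewrite mem_iota => /(_ (ltn_ord j))/eqP ijE; split.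
  case=> ij [l [il jl]]; apply/eqP; rewrite ijE; apply/andP; split.
    by apply/eqP=> /val_inj.
  apply/hasP; exists (nth [::] H21_lines l); last by rewrite il jl.
  by apply: mem_nth; rewrite size_H21_lines.
move/eqP; rewrite ijE => /andP[/eqP ij /hasP[s /(nthP [::])[l]]].
rewrite size_H21_lines => l14 <- /andP[il jl]; split.
  by move=> eq_ij; apply: ij; rewrite eq_ij.
by exists (Ordinal l14).
Qed.

(** The checks say that [H21_dist] vanishes exactly on the diagonal, that from distance at least 2
    some neighbour is nearer by one, and that no neighbour is nearer by more. Together with the
    description of collinearity this characterizes the graph distance. *)
Lemma H21_model_distance (i j : points H21_model) : distance i j (H21_dist i j).
Proof.
have /allP chk : all (fun i => all (fun j =>
    [&& (H21_dist i j == 0) == (i == j),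
        (H21_dist i j < 2) || has (fun k => (H21_dist i k == 1) &&
           (H21_dist i j == (H21_dist k j).+1)) (iota 0 21)
      & all (fun k => (H21_dist i k == 1) ==>
           (H21_dist i j <= (H21_dist k j).+1)) (iota 0 21)])
    (iota 0 21)) (iota 0 21).
  by vm_compute.
have in21 (k : 'I_21) : (k : nat) \in iota 0 21 by rewrite mem_iota ltn_ord.
have chkP (k l : 'I_21) := allP (chk k (in21 k)) l (in21 l).
have d0 (k : 'I_21) : H21_dist k k = 0.
  by have /and3P[/eqP + _ _] := chkP k k; rewrite eqxx => /eqP.
split.
- move dij: (H21_dist i j) => n; elim: n i dij => [|n IHn] i dij /=.
    by have /and3P[/eqP + _ _] := chkP i j; rewrite dij => /esym/eqP/val_inj.
  have /and3P[_ + _] := chkP i j; rewrite dij; case: n IHn dij => [|n] IHn dij.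
    by move=> _; exists j; [apply/H21_model_collinear | ].
  move=> /hasP[k]; rewrite mem_iota => k21 /andP[/eqP ik /eqP[kj]].
  exists (Ordinal k21 : points H21_model); first exact/H21_model_collinear.
  by apply: IHn.
- move=> m; elim: m i => [|m IHm] i /=; first by move=> ->; rewrite d0.
  move=> [k /H21_model_collinear ik /IHm le_kj].
  have /and3P[_ _ /allP/(_ k (in21 k))] := chkP i j; rewrite ik => le_ij.
  exact: leq_trans le_ij _.
Qed.

(** * Lines and distances in a near hexagon of order (2,2) *)

Lemma card_I3_enum (T : Type) (A : set T) : (A #= `I_3)%card ->
  exists a b c, [/\ a <> b, a <> c, b <> c
    & forall z, A z <-> [\/ z = a, z = b | z = c]].
Proof.
move=> /card_set_bijP[f [fI f_inj f_surj]].
have [a Aa fa] := f_surj 0 isT; have [b Ab fb] := f_surj 1 isT.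
have [c Ac fc] := f_surj 2 isT.
exists a, b, c; split; try by move=> eq_; move: fa fb fc; rewrite eq_ => -> //.
- by move=> eq_; move: fb fc; rewrite eq_ => ->.
- move=> z; split=> [Az|[]->//]; have := fI z Az; rewrite /= -/(f z).
  have eqz y : A y -> f z = f y -> z = y.
    by move=> Ay; apply: f_inj; apply/mem_set.
  case fz: (f z) => [|[|[|//]]] _; [constructor 1|constructor 2|constructor 3];
    by apply: eqz; rewrite // fz.
Qed.

Section NearHexagon.

Variable N : geometry.
Hypotheses (nearN : near_hexagon N) (orderN : has_order N 2 2).

Definition line3 (l : lines N) x y z :=
  [/\ x <> y, x <> z, y <> z & forall w, inc w l <-> [\/ w = x, w = y | w = z]].

Lemma line3_rot l x y z : line3 l x y z -> line3 l y z x.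
Proof.
case=> xy xz yz lE; split; [exact: yz|exact/nesym|exact/nesym|move=> w;
  rewrite lE].
by split=> -[]; [constructor 3|constructor 1|constructor 2|constructor 2|
  constructor 3|constructor 1].
Qed.

Lemma line3_swap l x y z : line3 l x y z -> line3 l x z y.
Proof.
case=> xy xz yz lE; split; [exact: xz|exact: xy|exact/nesym|move=> w;
  rewrite lE].
by split=> -[]; [constructor 1|constructor 3|constructor 2|constructor 1|
  constructor 3|constructor 2].
Qed.

Lemma line3_inc l x y z : line3 l x y z -> [/\ inc x l, inc y l & inc z l].
Proof.
by case=> _ _ _ lE; split; apply/lE; [constructor 1|constructor 2|constructor
  3].
Qed.

Lemma line3_collinear l x y z : line3 l x y z -> collinear x y.
Proof.
by move=> l3; have [xl yl _] := line3_inc l3; case: l3 => xy _ _ _;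
  split=> //; exists l.
Qed.

Lemma line3_through (l : lines N) x : inc x l -> exists y z, line3 l x y z.
Proof.
have [a [b [c [ab ac bc lE]]]] := card_I3_enum (orderN.1 l).
have l3 : line3 l a b c by split.
move=> /lE[]->; [by exists b, c | exists c, a | exists a, b].
- exact: line3_rot.
- exact/line3_rot/line3_rot.
Qed.

Lemma line3_of_incident (l : lines N) x y : inc x l -> inc y l -> x <> y ->
  exists z, line3 l x y z.
Proof.
move=> xl yl xy; have [a [b l3]] := line3_through xl.
have [_ _ _ lE] := l3; move/lE: yl xy => []->// _; first by exists b.
by exists a; apply: line3_swap.
Qed.

Lemma line3_of_collinear (x y : points N) : collinear x y ->
  exists l z, line3 l x y z.
Proof.
case=> xy [l [xl yl]]; have [z l3] := line3_of_incident xl yl xy.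
by exists l, z.
Qed.

Lemma line3_complete (l : lines N) x y z : inc x l -> inc y l -> inc z l ->
  x <> y -> x <> z -> y <> z -> line3 l x y z.
Proof.
move=> xl yl zl xy xz yz; have [w l3] := line3_of_incident xl yl xy.
by have [_ _ _ lE] := l3; move/lE: zl xz yz => []->.
Qed.

Lemma lines_through (x : points N) :
  exists l1 l2 l3, [/\ l1 <> l2, l1 <> l3, l2 <> l3
  & forall l, inc x l <-> [\/ l = l1, l = l2 | l = l3]].
Proof. exact: card_I3_enum (orderN.2 x). Qed.

Lemma three_lines_through (x : points N) l1 l2 l3 :
  inc x l1 -> inc x l2 -> inc x l3 ->
  l1 <> l2 -> l1 <> l3 -> l2 <> l3 ->
  forall l, inc x l -> [\/ l = l1, l = l2 | l = l3].
Proof.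
have [k1 [k2 [k3 [_ _ _ xE]]]] := lines_through x.
move=> /xE[]-> /xE[]-> /xE[]-> // _ _ _ l /xE[]->;
  by [constructor 1|constructor 2|constructor 3].
Qed.

Lemma two_other_lines (x : points N) l1 : inc x l1 -> exists l2 l3,
  [/\ l1 <> l2, l1 <> l3, l2 <> l3
    & forall l, inc x l <-> [\/ l = l1, l = l2 | l = l3]].
Proof.
have [k1 [k2 [k3 [k12 k13 k23 xE]]]] := lines_through x.
move=> /xE[]->.
- by exists k2, k3.
- exists k1, k3; split; [exact/nesym|by []|by []|move=> l; rewrite xE].
  by split=> -[]; [constructor 2|constructor 1|constructor 3|constructor 2|
    constructor 1|constructor 3].
- exists k1, k2; split; [exact/nesym|exact/nesym|by []|move=> l; rewrite xE].
  by split=> -[]; [constructor 2|constructor 3|constructor 1|constructor 3|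
    constructor 1|constructor 2].
Qed.

Lemma line_unique (x y : points N) k l :
  x <> y -> inc x k -> inc y k -> inc x l -> inc y l -> k = l.
Proof. by case: nearN => pls _ _; apply: pls. Qed.

Lemma dist_exists (x : points N) :
  exists d : points N -> nat, forall y, distance x y (d y).
Proof.
have /choice[d dP] (y : points N) : exists n, distance x y n.
  by case: nearN => _ [/(_ x y)[n xy _] _] _; exists n.
by exists d.
Qed.

Definition dist x : points N -> nat := projT1 (cid (dist_exists x)).

Lemma distP x y : distance x y (dist x y).
Proof. by rewrite /dist; case: (cid _). Qed.

Lemma dist_eq x y n : distance x y n -> dist x y = n.
Proof. exact: distance_unique (distP x y). Qed.

Lemma dist_le3 x y : dist x y <= 3.
Proof.
by case: nearN => _ [/(_ x y)[n /dist_eq -> //] _] _.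
Qed.

Lemma dist_le_walk x y n : walk n x y -> dist x y <= n.
Proof. by have [_] := distP x y; apply. Qed.

Lemma dist_xx x : dist x x = 0.
Proof. by apply/eqP; rewrite -leqn0; apply: dist_le_walk. Qed.

Lemma dist_eq0 x y : dist x y = 0 -> x = y.
Proof. by have [+ _] := distP x y => /[swap] ->. Qed.

Lemma dist_sym x y : dist x y = dist y x.
Proof.
by apply/eqP; rewrite eqn_leq !dist_le_walk //; apply: walk_sym;
  have [] := distP x y; have [] := distP y x.
Qed.

Lemma dist_collinear x y : collinear x y -> dist x y = 1.
Proof.
move=> xy; have : dist x y <= 1 by apply: dist_le_walk; exists y.
by case dxy: (dist x y) => [|[|]] // _; case: xy => + _; case; apply: dist_eq0.
Qed.

Lemma dist1_collinear x y : dist x y = 1 -> collinear x y.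
Proof. by have [+ _] := distP x y => /[swap] -> [z xz /= <-]. Qed.

Lemma dist_le_collinear w y z : collinear y z -> dist w z <= (dist w y).+1.
Proof.
move=> yz; apply: dist_le_walk; rewrite -addn1.
by have [wy _] := distP w y; apply: walk_cat wy _; exists z.
Qed.

Lemma dist_step x y n : dist x y = n.+1 ->
  exists2 z, collinear x z & dist z y = n.
Proof.
move=> dxy; have [] := distP x y; rewrite dxy => -[z xz zy] _; exists z => //.
apply/eqP; rewrite eqn_leq dist_le_walk //= -ltnS -dxy dist_sym (dist_sym z).
exact/dist_le_collinear/collinear_sym.
Qed.

(** A tie would make [z] a second nearest point, and distances to collinear points differ by at most
    one. *)
Lemma nearest_dist w (l : lines N) p z : nearest w l p -> inc z l -> z <> p ->
  dist w z = (dist w p).+1.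
Proof.
move=> wlp zl zp; have [pl p_min] := wlp.
have le_pz u : inc u l -> dist w p <= dist w u.
  by move=> ul; apply: p_min ul (distP w p) (distP w u).
have := @dist_le_collinear w p z; have := le_pz z zl.
rewrite leq_eqVlt => /orP[/eqP eq_pz _|lt_pz le_zp].
  case: nearN => _ _ /(_ w l)[q [_ q_uniq]]; case: zp.
  rewrite -(q_uniq z) ?(q_uniq p) //; split=> // u m n ul.
  by move=> /dist_eq <- /dist_eq <-; rewrite -eq_pz le_pz.
apply/eqP; rewrite eqn_leq lt_pz le_zp //; split; first exact/nesym.
by exists l.
Qed.

Lemma nearest_on_line3 w l x y z : line3 l x y z ->
  nearest_on_line (dist w x) (dist w y) (dist w z).
Proof.
move=> l3; have [xl yl zl] := line3_inc l3; have [xy xz yz lE] := l3.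
have [p [wlp _]] : exists! p, nearest w l p by case: nearN.
have d u := nearest_dist (z := u) wlp; have [/lE p_l _] := wlp.
apply/or3P; case: p_l d => -> d.
- by constructor 1; rewrite (d y) ?(d z) ?eqxx //; apply/nesym.
- by constructor 2; rewrite (d x) ?(d z) ?eqxx //; apply/nesym.
- by constructor 3; rewrite (d x) ?(d y) ?eqxx.
Qed.

End NearHexagon.

(** * Valuations of a near hexagon *)

Section Embedding.

Variable N : geometry.
Hypotheses (nearN : near_hexagon N) (orderN : has_order N 2 2).
(** [e] numbers the points of the embedded H(2,1) in the order of the flags, through its values
    below 21; [dist_e] expresses the isometry. *)
Variable e : nat -> points N.
Notation dist := (dist nearN).
Hypothesis dist_e : forall i j, i < 21 -> j < 21 ->
  dist (e i) (e j) = H21_dist i j.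
Hypothesis line_e : forall s, s \in H21_lines ->
  exists l, forall i, i \in s -> inc (e i) l.

(* Sealed by opacity, because unfolding it makes conversion diverge. *)
Lemma F_sig : {F : points N -> seq nat |
  forall x, F x = [seq dist x (e i) | i <- iota 0 21]}.
Proof. by exists (fun x => [seq dist x (e i) | i <- iota 0 21]). Qed.

Definition F : points N -> seq nat := sval F_sig.

Lemma FE x : F x = [seq dist x (e i) | i <- iota 0 21].
Proof. exact: svalP F_sig x. Qed.

Lemma nth_F x i : i < 21 -> at_ (F x) i = dist x (e i).
Proof. by move=> i21; rewrite FE (nth_map 0) ?size_iota // nth_iota. Qed.

Lemma size_F x : size (F x) = 21.
Proof. by rewrite FE size_map size_iota. Qed.

Lemma F_e i : i < 21 -> F (e i) = H21_row i.
Proof.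
by move=> i21; rewrite FE; apply/eq_in_map=> j; rewrite mem_iota => j21;
  rewrite dist_e.
Qed.

Lemma F_eq0 x i : i < 21 -> at_ (F x) i = 0 -> x = e i.
Proof. by move=> i21; rewrite nth_F // => /dist_eq0. Qed.

Lemma F_line l x y z : line3 l x y z ->
  on_line (F x) (F y) /\ third (F x) (F y) = F z.
Proof.
move=> l3; rewrite !FE; apply: on_line_map => i.
rewrite !(dist_sym nearN _ (e i)); exact: (nearest_on_line3 nearN _ l3).
Qed.

Definition inH x := exists2 i, i < 21 & x = e i.

Lemma e_inj i j : i < 21 -> j < 21 -> e i = e j -> i = j.
Proof.
by move=> i21 j21 ij; apply: H21_dist_eq0; rewrite // -dist_e // ij dist_xx.
Qed.

Lemma line_e3 i j k : [:: i; j; k] \in H21_lines ->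
  exists l, line3 l (e i) (e j) (e k).
Proof.
move=> /[dup] l_line /line_e[l lP]; exists l.
have [i' [j' [k' [[<- <- <-] ij jk k21]]]] := H21_lines_sorted l_line.
have [il jl kl] : [/\ inc (e i) l, inc (e j) l & inc (e k) l].
  by split; apply: lP; rewrite !inE eqxx ?orbT.
by apply: (line3_complete orderN); rewrite // => /e_inj; lia.
Qed.

Lemma F_valuation x : ~ inH x -> F x \in valuations.
Proof.
move=> xH; apply: valuations_complete; first exact: size_F.
  apply/allP=> a; rewrite FE => /mapP[i]; rewrite mem_iota => /= i21 ->.
  have := dist_le3 nearN x (e i); case dxi: (dist x (e i)) => [|[|[|[|]]]] // _.
  by case: xH; exists i => //; apply: (dist_eq0 dxi).
move=> i j k l_line; have [l l3] := line_e3 l_line.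
have [i' [j' [k' [[<- <- <-] ij jk k21]]]] := H21_lines_sorted l_line.
by rewrite !nth_F; [exact: nearest_on_line3 l3|lia..].
Qed.

Lemma F_inH x : inH x -> F x \in H21_rows.
Proof. by move=> [i i21 ->]; rewrite F_e // H21_rows.unlock map_f // mem_iota.
Qed.

Lemma F_gt0 x i : ~ inH x -> i < 21 -> 0 < at_ (F x) i.
Proof.
by move=> xH i21; rewrite lt0n; apply/eqP=> /(F_eq0 i21) xi; apply: xH;
  exists i.
Qed.

(** * The covering condition *)

Lemma F_partners V l x y z : (forall x, F x \in V) -> line3 l x y z ->
  (F y, F z) \in partners V (F x).
Proof.
move=> FV /F_line[xy xyz]; apply/mapP; exists (F y); last by rewrite xyz.
by rewrite mem_filter xy xyz !FV.
Qed.

Lemma F_step x i : ~ inH x -> i < 21 ->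
  exists l z z', line3 l x z z' /\ at_ (F z) i < at_ (F x) i.
Proof.
move=> xH i21; have := F_gt0 xH i21; rewrite nth_F //.
case dxi: (dist x (e i)) => [//|n] _; have [z xz zi] := dist_step dxi.
have [l [z' l3]] := line3_of_collinear orderN xz.
by exists l, z, z'; rewrite nth_F // zi.
Qed.

(** A shortest path from [x] to a point of H(2,1) starts on one of the three lines on [x]. Positions
    not approached on the given line are approached on one of the other two, which supply the two
    pairs. *)
Lemma F_coverable2 V l x z z' : (forall x, F x \in V) -> ~ inH x ->
  line3 l x z z' ->
  coverable (partners V (F x)) 2 (F x)
    (uncovered (F x) (F z, F z') (iota 0 21)).
Proof.
move=> FV xH l3; have [xl zl z'l] := line3_inc l3.
have [l2 [l3' [ne12 ne13 ne23 xE]]] := two_other_lines orderN xl.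
have [xl2 xl3] : inc x l2 /\ inc x l3'.
  by split; apply/xE; [constructor 2|constructor 3].
have [u [u' lu]] := line3_through orderN xl2.
have [v [v' lv]] := line3_through orderN xl3.
apply: (@coverable_complete _ [:: (F u, F u'); (F v, F v')]) => //.
  move=> q; rewrite !inE => /orP[]/eqP->; split; apply: F_partners => //;
    by [exact: lu | exact: lv | exact: line3_swap lu | exact: line3_swap lv].
move=> i; rewrite mem_uncovered mem_iota => /and3P[iz iz' i21].
have [k [w [w' [lw wi]]]] := F_step xH i21.
have [xk wk _] := line3_inc lw; have [xw _ _ _] := lw.
have on_k m a b : k = m -> line3 m x a b -> w = a \/ w = b.
  move=> km [_ _ _ mE]; move: wk; rewrite km => /mE[] wE; [|by left|by right].
  by case: xw.
case/xE: xk => km.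
- by case: (on_k _ _ _ km l3) wi => ->; rewrite ltnNge ?iz ?iz'.
- exists (F u, F u'); rewrite ?inE ?eqxx //=.
  by case: (on_k _ _ _ km lu) => <-; rewrite wi ?orbT.
- exists (F v, F v'); rewrite ?inE ?eqxx ?orbT //=.
  by case: (on_k _ _ _ km lv) => <-; rewrite wi ?orbT.
Qed.

Lemma F_coverable3 V x : (forall x, F x \in V) -> ~ inH x ->
  coverable_by V 3 (F x) (iota 0 21).
Proof.
(* Position 0 heads the list, so a line approaching it is a valid first choice of the search. *)
move=> FV xH; have [l [z [z' [l3 z0]]]] := F_step xH (isT : 0 < 21).
rewrite /coverable_by; apply: (@coverable_step _ _ _ _ (F z, F z')).
- exact: F_partners l3.
- exact: z0.
- exact: F_coverable2 l3.
Qed.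

Lemma F_count x : ~ inH x -> count_mem 1 (F x) < 3.
Proof.
move=> xH; rewrite ltnNge; apply/negP=> ge3.
apply: (@not_coverable_ge3 (F x)).
  by rewrite mem_valuations_of ge3 F_valuation.
apply: F_coverable3 xH => y; have [/F_inH yH|yH] := EM (inH y);
  first by rewrite mem_cat yH.
by rewrite mem_cat F_valuation ?orbT.
Qed.

Lemma F_V012 x : F x \in V012.
Proof.
rewrite mem_cat; have [/F_inH ->//|xH] := EM (inH x).
rewrite mem_valuations_of F_valuation // andbT orbC; apply/orP; left.
exact: F_count.
Qed.

Lemma two_neighbour x z : ~ inH x -> ~ inH z -> collinear x z ->
  count_mem 1 (F x) = 2 -> count_mem 1 (F z) = 2.
Proof.
move=> xH zH /(line3_of_collinear orderN)[l [z' l3]] x2.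
apply/eqP; rewrite eqn_leq -ltnS F_count // leqNgt; apply/negP=> lt_z2.
case: (@not_coverable_pair (F x) (F z, F z')).
- by rewrite mem_valuations_of x2 F_valuation.
- exact: F_partners F_V012 l3.
- by rewrite mem_valuations_of F_valuation // andbT.
- exact: F_coverable2 F_V012 xH l3.
Qed.

(** * The exterior lines on the points of H(2,1) *)

Lemma line_eP s : s \in H21_lines ->
  exists l, forall z, inc z l <-> exists2 k, k \in s & z = e k.
Proof.
move=> s_line; have [i [j [k [sE _ _ _]]]] := H21_lines_sorted s_line.
rewrite sE in s_line *; have [l l3] := line_e3 s_line.
exists l => z; have [_ _ _ lE] := l3; rewrite lE; split.
- by case=> ->; [exists i | exists j | exists k]; rewrite ?inE ?eqxx ?orbT.
- move=> [m + ->]; rewrite !inE => /or3P[] /eqP->;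
    by [constructor 1|constructor 2|constructor 3].
Qed.

(** Two of the three lines of N on a point of H(2,1) belong to H(2,1) and contain all its neighbours
    there. By isometry the third line has no other point in H(2,1), and so every outside neighbour
    is on it. *)
Lemma ext_line i : i < 21 -> exists l x x',
  [/\ line3 l (e i) x x', ~ inH x, ~ inH x'
    & forall y, ~ inH y -> dist y (e i) = 1 -> y = x \/ y = x'].
Proof.
(* [s1] and [s2] are the two lines of H(2,1) on [i]; the third test makes them distinct and the
   fourth says that they contain all neighbours of [i]. *)
move=> i21; have /allP chk : all (fun i => has (fun s1 => has (fun s2 =>
    [&& i \in s1, i \in s2, has [predC s2] s1
      & all (fun j => (H21_dist i j == 1) ==>
    ((j \in s1) || (j \in s2))) (iota 0 21)]) H21_lines) H21_lines) (iota 0 21).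
  by vm_compute.
have := chk i; rewrite mem_iota => /(_ i21).
case/hasP=> s1 s1_line /hasP[s2 s2_line /and4P[is1 is2 /hasP[j js1 js2]]].
move=> /allP s12; have [l1 l1E] := line_eP s1_line;
  have [l2 l2E] := line_eP s2_line.
have lt21 s k : s \in H21_lines -> k \in s -> k < 21.
  move=> /H21_lines_sorted[a [b [c [-> ab bc c21]]]].
  by rewrite !inE => /or3P[] /eqP->; lia.
have l12 : l1 <> l2.
  move=> l12; have /l2E[k ks2 /e_inj jk] : inc (e j) l2 by rewrite -l12 l1E;
    exists j.
  by move/negP: js2; apply; rewrite jk;
    [exact: ks2|exact: lt21 js1|exact: lt21 ks2].
have [il1 il2] : inc (e i) l1 /\ inc (e i) l2 by split; [apply/l1E|apply/l2E];
  exists i.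
have [l [il l1l l2l iE]] : exists l, [/\ inc (e i) l, l1 <> l, l2 <> l
    & forall k, inc (e i) k -> [\/ k = l1, k = l2 | k = l]].
  have [k1 [k2 [ne1 ne2 ne3 iE]]] := two_other_lines orderN il1.
  case/iE: (il2) => l2E'; first by case: l12.
  - exists k2; split; [by apply/iE; constructor 3|by []|by rewrite l2E'|].
    by move=> k; rewrite iE -l2E'.
  - exists k1; split; [by apply/iE; constructor 2|by []|by rewrite l2E';
      apply/nesym|].
    move=> k /iE[]->; rewrite -?l2E';
      by [constructor 1|constructor 3|constructor 2].
have extH z : inc z l -> z <> e i -> ~ inH z.
  move=> zl zi [k k21 zk]; have iz : e i <> z by exact/nesym.
  have : H21_dist i k = 1.
    by rewrite -dist_e // -zk; apply: dist_collinear; split=> //; exists l.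
  have /s12 : k \in iota 0 21 by rewrite mem_iota.
  move=> /implyP/[swap] /eqP /[swap]/[apply] /orP[] ks.
  - by case: l1l; apply: (line_unique nearN iz); rewrite // l1E; exists k.
  - by case: l2l; apply: (line_unique nearN iz); rewrite // l2E; exists k.
have [x [x' l3]] := line3_through orderN il.
have [_ xl x'l] := line3_inc l3; have [ix ix' _ lE] := l3.
exists l, x, x'; split=> //; [by apply: extH => //; apply/nesym..|].
move=> y yH /(@dist1_collinear _ nearN)[yi [k [yk ik]]].
case/iE: ik => kE; rewrite {}kE in yk.
- by case/l1E: yk => m ms1 yE; case: yH; exists m => //; apply: lt21 ms1.
- by case/l2E: yk => m ms2 yE; case: yH; exists m => //; apply: lt21 ms2.
- by case/lE: yk => // ->; [left | right].
Qed.

Lemma ext_unique i x y : i < 21 -> ~ inH x -> ~ inH y ->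
  at_ (F x) i = 1 -> at_ (F y) i = 1 ->
  y = x \/ F y = third (F x) (H21_row i).
Proof.
move=> i21 xH yH; rewrite !nth_F // => xi yi.
have [l [a [a' [l3 _ _ aE]]]] := ext_line i21.
have eqF u v : line3 l (e i) u v -> F v = third (F u) (H21_row i).
  by move=> /line3_swap/line3_rot/line3_rot/F_line[_ <-]; rewrite F_e.
have l3' := line3_swap l3.
case: (aE x xH xi) (aE y yH yi) => -> [] ->; [by left|right|right|by left];
  exact: eqF.
Qed.

Lemma ext_third i x : i < 21 -> ~ inH x -> at_ (F x) i = 1 ->
  exists y, ~ inH y /\ F y = third (F x) (H21_row i).
Proof.
move=> i21 xH; rewrite nth_F // => xi.
have [l [a [a' [l3 aH a'H aE]]]] := ext_line i21.
have eqF u v : line3 l (e i) u v -> F v = third (F u) (H21_row i).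
  by move=> /line3_swap/line3_rot/line3_rot/F_line[_ <-]; rewrite F_e.
case: (aE x xH xi) => ->; [exists a' | exists a]; split=> //; apply: eqF => //.
exact: line3_swap.
Qed.

Lemma ext_exists i : i < 21 -> exists x, ~ inH x /\ at_ (F x) i = 1.
Proof.
move=> i21; have [l [x [x' [l3 xH _ _]]]] := ext_line i21.
exists x; rewrite nth_F // (dist_sym nearN); split=> //.
exact/dist_collinear/(line3_collinear l3).
Qed.

(** * Neighbours of H(2,1) with a single one *)

Definition single i x := [/\ ~ inH x, at_ (F x) i = 1 & count_mem 1 (F x) = 1].

Lemma single_valuation i x : single i x -> F x \in valuations_of (pred1 1).
Proof. by case=> xH _ x1; rewrite mem_valuations_of x1 F_valuation. Qed.

Lemma count1_index (T : eqType) (x0 a : T) s i :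
  count_mem a s = 1 -> i < size s -> nth x0 s i = a -> index a s = i.
Proof.
elim: s i => [|b s IHs] [|i] //= sa i_s ia; first by rewrite ia eqxx.
have a_s : a \in s by rewrite -ia mem_nth.
move: sa; case: eqP => [_|_] /= sa; last by rewrite (IHs i).
by move: a_s; rewrite -has_pred1 has_count; lia.
Qed.

Lemma single_index i x : i < 21 -> single i x -> index 1 (F x) = i.
Proof. by move=> i21 [_ xi x1]; apply: count1_index xi; rewrite ?size_F. Qed.

Lemma single_third i x : i < 21 -> single i x ->
  exists y, [/\ single i y, F y = third (F x) (H21_row i), F x <> F y
    & forall j, j < 21 -> H21_dist i j = 3 ->
      at_ (F x) j = 2 \/ at_ (F y) j = 2].
Proof.
move=> i21 sx; have [xH xi x1] := sx.
have [] := one_third (single_valuation sx); rewrite (single_index i21 sx).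
have [y [yH yE]] := ext_third i21 xH xi; rewrite -yE.
rewrite mem_valuations_of => fg /andP[/eqP y1 _] yi opp.
exists y; split=> //; split=> //; rewrite -yi nth_index //.
by rewrite -has_pred1 has_count y1.
Qed.

(** From a point at distance 2 from [e j] a step leads to a neighbour [z] of [e j]. It is outside
    H(2,1), where the only neighbour of the starting point is [e i], at distance 3 from [e j]. It
    does not have two ones, as these would propagate back to the starting point. *)
Lemma single_opposite i j x :
  i < 21 -> j < 21 -> H21_dist i j = 3 -> single i x ->
  exists y, single j y.
Proof.
move=> i21 j21 ij sx; have [y [sy _ _ /(_ j j21 ij) xyj]] := single_third i21
  sx.
(* [x] and [y] are interchangeable; keep the one at distance 2 from [e j]. *)
wlog xj : x y {xyj} sx sy / at_ (F x) j = 2.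
  by move=> wl; case: xyj; [apply: (wl x y) | apply: (wl y x)].
have [xH xi x1] := sx; rewrite nth_F // in xj.
have [z xz zj] := dist_step xj.
have zH : ~ inH z.
  case=> k k21 zk; have xk : at_ (F x) k = 1.
    by rewrite nth_F // -zk; apply: dist_collinear.
  have ik : i = k by rewrite -(single_index i21 sx); apply: count1_index xk;
    rewrite ?size_F.
  by move: zj; rewrite zk dist_e // -ik ij.
exists z; split=> //; first by rewrite nth_F.
have z_gt0 : 0 < count_mem 1 (F z).
  rewrite -has_count has_pred1 -(nth_F z j21) in zj *.
  by rewrite -zj mem_nth ?size_F.
case: (count_mem 1 (F z)) (F_count zH) z_gt0 (two_neighbour zH xH
  (collinear_sym xz)).
  by [].
by case=> [|[|//]] // _ _ /(_ erefl); rewrite x1.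
Qed.

Lemma single_all i j x : i < 21 -> j < 21 -> single i x -> exists y, single j y.
Proof.
move=> i21 j21 sx; have [k [k21 ik kj]] := opposite_connected i21 j21.
have [y sy] := single_opposite i21 k21 ik sx.
exact: single_opposite k21 j21 kj sy.
Qed.

(** * Exclusion of the valuations with two ones or none *)

Definition double x := ~ inH x /\ count_mem 1 (F x) = 2.

Lemma double_valuation x : double x -> F x \in valuations_of (pred1 2).
Proof. by case=> xH x2; rewrite mem_valuations_of x2 F_valuation. Qed.

Lemma double_third i x : i < 21 -> double x -> at_ (F x) i = 1 ->
  exists y, [/\ double y, F y = third (F x) (H21_row i), at_ (F y) i = 1
    & center (F y) = center (F x)].
Proof.
move=> i21 dx xi; have [xH _] := dx; have [y [yH yE]] := ext_third i21 xH xi.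
have [] := center_third (double_valuation dx) i21 xi; rewrite -yE.
rewrite mem_valuations_of => /andP[/eqP y2 _] yi yc.
exists y; split; [exact: conj yH y2 | exact: erefl | exact: yi | exact: yc].
Qed.

Lemma F_has1 x : 0 < count_mem 1 (F x) -> exists i, i < 21 /\ at_ (F x) i = 1.
Proof.
rewrite -has_count => /(has_nthP 0)[i]; rewrite size_F => i21 /eqP xi.
by exists i.
Qed.

Lemma single_or_double i x : ~ inH x -> i < 21 -> at_ (F x) i = 1 ->
  single i x \/ double x.
Proof.
move=> xH i21 xi; have lt3 := F_count xH.
have gt0 : 0 < count_mem 1 (F x).
  by rewrite -has_count has_pred1 -xi mem_nth ?size_F.
by case x1: (count_mem 1 (F x)) lt3 gt0 => [|[|[|]]] //; [left | right].
Qed.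

Lemma sum_nat_count (p : pred nat) n :
  \sum_(i < n) (p i : nat) = count p (iota 0 n).
Proof.
rewrite -(big_mkord xpredT (fun i => p i : nat)) /index_iota subn0.
rewrite -sum1_count [RHS]big_mkcond.
by apply: eq_bigr => i _; case: (p i).
Qed.

(* Otherwise every point of H(2,1) has a center, the center of the grid on its
   exterior line; a point is the center of no or of four points, but 4 does not
   divide 21. *)
Lemma single_exists : exists i x, i < 21 /\ single i x.
Proof.
apply/not_existsP => no_single.
have dbl i x : i < 21 -> ~ inH x -> at_ (F x) i = 1 -> double x.
  move=> i21 xH xi; case: (single_or_double xH i21 xi) => // sx.
  by case: (no_single i); exists x.
have /choice[ext extP] i : exists x, i < 21 -> ~ inH x /\ at_ (F x) i = 1.
  have [/ext_exists[x xP]|] := ltnP i 21; first by exists x.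
  (* An arbitrary value for indices from 21 on. *)
  by exists (e 0).
pose c i := center (F (ext i)).
have c_eq i x : i < 21 -> ~ inH x -> at_ (F x) i = 1 -> center (F x) = c i.
  move=> i21 xH xi; have [eH ei] := extP i i21.
  have [-> //|xE] := ext_unique i21 eH xH ei xi.
  have [y [_ yE _ yc]] := double_third i21 (dbl _ _ i21 eH ei) ei.
  rewrite /c -yc yE -xE; reflexivity.
have c_val i : i < 21 -> F (ext i) \in valuations_of (pred1 2).
  by move=> i21; have [eH ei] := extP i i21; apply/double_valuation/(dbl i).
(* The fibre of [c] over a center is the set of its neighbours: the center stays the same at every
   one of a valuation and on passing to the third point of an exterior line. *)
have c_fibre i j : i < 21 -> j < 21 -> (c j == c i) = (H21_dist (c i) j == 1).
  move=> i21 j21; apply/eqP/eqP => [<-|].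
    have [_ ej] := extP j j21; have [_ /(_ j j21)] := center_two (c_val j j21).
    by case=> _; apply; left.
  have [eH ei] := extP i i21; have [_ /(_ j j21)[cP _]] := center_two (c_val i
    i21).
  move=> /cP[ej|[k [k21 ek tj]]]; first exact: esym (c_eq j _ j21 eH ej).
  have [y [[yH _] yE _ yc]] := double_third k21 (dbl _ _ i21 eH ei) ek.
  have yj : at_ (F y) j = 1 by rewrite yE.
  by rewrite -(c_eq j y j21 yH yj) yc; reflexivity.
have c21 i : i < 21 -> c i < 21.
  by move=> i21; have [] := center_two (c_val i i21).
suff: 4 %| 21 by [].
(* Count the 21 points by their center: each fibre is empty or consists of the four neighbours of a
   point. *)
have -> : 21 = \sum_(i < 21) \sum_(w < 21) (c i == w : nat).
  rewrite -[LHS]card_ord -sum1_card; apply: eq_bigr => i _.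
  rewrite (bigD1 (Ordinal (c21 i (ltn_ord i)))) //= eqxx big1 // => w.
  by rewrite eq_sym => /negPf wi; move: wi; rewrite -val_eqE /= => ->.
rewrite exchange_big; apply: dvdn_sum => w _.
have [[i [i21 wE]]|no_i] := EM (exists i, i < 21 /\ c i = w).
  rewrite -wE (eq_bigr (fun j : 'I_21 => (H21_dist (c i) j == 1 : nat))).
    by rewrite (sum_nat_count (fun j => H21_dist (c i) j == 1)) H21_degree ?c21.
  by move=> j _; rewrite c_fibre.
rewrite big1 // => j _; apply/eqP; rewrite eqb0; apply/eqP => jw.
by apply: no_i; exists j.
Qed.

Lemma single_all_points i : i < 21 -> exists x, single i x.
Proof.
by move=> i21; have [j [x [j21 sx]]] := single_exists;
  apply: single_all j21 i21 sx.
Qed.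

(** At a one of [x] there is also an outside neighbour with a single one. Both lie on the same
    exterior line, but if one outer point of such a line has two ones, so has the other. *)
Lemma no_double x : ~ double x.
Proof.
move=> dx; have [xH x2] := dx.
have [i [i21 xi]] : exists i, i < 21 /\ at_ (F x) i = 1 by apply: F_has1;
  rewrite x2.
have [z [zH zi z1]] := single_all_points i21.
have [zx|zE] := ext_unique i21 xH zH xi zi; first by rewrite zx x2 in z1.
have [y [[_ y2] yE _ _]] := double_third i21 dx xi.
by rewrite zE -yE y2 in z1.
Qed.

Lemma F_count_le1 x : ~ inH x -> count_mem 1 (F x) < 2.
Proof.
move=> xH; have := F_count xH; rewrite ltnS leq_eqVlt => /orP[/eqP x2|//].
by case: (@no_double x).
Qed.

Lemma F_V01 x : F x \in V01.
Proof.
rewrite mem_cat; have [/F_inH ->//|xH] := EM (inH x).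
rewrite mem_valuations_of F_valuation // andbT orbC; apply/orP; left.
exact: F_count_le1.
Qed.

Lemma F_count1 x : ~ inH x -> count_mem 1 (F x) = 1.
Proof.
move=> xH; case x1: (count_mem 1 (F x)) (F_count_le1 xH) => [|[|]] // _.
case: (@not_coverable_0 (F x)); last exact: F_coverable3 F_V01 xH.
by rewrite mem_valuations_of x1 F_valuation.
Qed.

Lemma F_single x : ~ inH x -> exists i, i < 21 /\ single i x.
Proof.
move=> xH; have x1 := F_count1 xH.
have [i [i21 xi]] : exists i, i < 21 /\ at_ (F x) i = 1 by apply: F_has1;
  rewrite x1.
by exists i.
Qed.

(** * Recovering N from its valuations *)

Lemma F_V1 x : F x \in V1.
Proof.
rewrite mem_cat; have [/F_inH ->//|xH] := EM (inH x).
by rewrite mem_valuations_of F_valuation // F_count1 // orbT.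
Qed.

(** A zero identifies a point of H(2,1). Outside, the position of the one leaves just the two outer
    points of an exterior line, and their valuations differ. *)
Lemma F_inj x y : F x = F y -> x = y.
Proof.
move=> xy; have [[i i21 xi]|xH] := EM (inH x).
  rewrite xi; apply/esym/(F_eq0 i21); rewrite -xy xi nth_F // dist_xx //.
have yH : ~ inH y.
  move=> [i i21 yi]; apply: xH; exists i => //; apply: (F_eq0 i21).
  by rewrite xy yi nth_F // dist_xx.
have [i [i21 sx]] := F_single xH; have [_ xi _] := sx.
have yi : at_ (F y) i = 1 by rewrite -xy.
have [-> //|yE] := ext_unique i21 xH yH xi yi.
have [z [_ zE xz _]] := single_third i21 sx.
by case: xz; rewrite xy yE zE.
Qed.

(** Every exterior line realizes both valuations with a single one at its point of H(2,1). *)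
Lemma F_surj f : f \in V1 -> exists x, F x = f.
Proof.
rewrite mem_cat => /orP[|f1].
  rewrite H21_rows.unlock => /mapP[i]; rewrite mem_iota => i21 ->.
  by exists (e i); rewrite F_e.
have i21 := one_index f1; have [x sx] := single_all_points i21.
have ix := single_index i21 sx.
have [fE|fE] := one_unique (single_valuation sx) f1 (esym ix);
  first by exists x.
have [xH xi _] := sx; have [y [_ yE]] := ext_third i21 xH xi.
by exists y; rewrite yE -ix; apply/esym.
Qed.

(** A first step from the point with valuation [f] towards the point of H(2,1) where [g] is smallest
    spans a line, and [forced] leaves only [g] and [h] for its other two points. *)
Lemma forced_line f g h : f \in V1 -> forced V1 f g h ->
  exists l x y z, [/\ line3 l x y z, F x = f, F y = g & F z = h].
Proof.
move=> /F_surj[x <-] /and3P[i21 xi /allP gh].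
rewrite nth_F // in xi; case dxi: (dist x _) xi => [//|n] _.
have [z xz zi] := dist_step dxi; have [l [z' l3]] := line3_of_collinear orderN
  xz.
have [xz_line xzz'] := F_line l3.
have := gh _ (F_V1 z); rewrite !nth_F // zi dxi ltnSn xz_line xzz' F_V1.
case/orP=> /andP[/eqP zE /eqP z'E]; first by exists l, x, z, z'.
by exists l, x, z', z; split=> //; apply: line3_swap.
Qed.

Lemma pencil_line v : v \in singular -> exists l : lines N, forall w,
  inc w l <-> F w \in [seq tits_row p | p <- pencil v].
Proof.
move=> v_s; have [f [g [h [pE fgh]]]] := pencil_forced v_s.
have fV : f \in V1.
  have [_ <-] := tits_rows_uniq_eq.
  have /mapP[p] : f \in [seq tits_row p | p <- pencil v] by rewrite pE inE eqxx.
  by rewrite mem_filter => /andP[_ p_t] ->; apply: map_f.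
have [l [x [y [z [l3 xf yg zh]]]]] := forced_line fV fgh.
exists l => w; have [_ _ _ lE] := l3; rewrite lE pE !inE -xf -yg -zh.
split=> [[]->|/or3P[]/eqP/F_inj->]; rewrite ?eqxx ?orbT //;
  by [constructor 1|constructor 2|constructor 3].
Qed.

Lemma model_iso : isomorphic H2D_model N.
Proof.
have line_in (i : 'I_63) : nth [::] tits_lines i \in tits_lines.
  by apply: mem_nth; rewrite size_tits_lines.
have sing_in (j : 'I_63) : nth [::] singular j \in singular.
  by apply: mem_nth; rewrite size_singular.
have [_ rowsE] := tits_rows_uniq_eq.
have /choice[f fP] (i : 'I_63) : exists x,
  F x = tits_row (nth [::] tits_lines i).
  by apply: F_surj; rewrite -rowsE map_f.
have /choice[g gP] (j : 'I_63) := pencil_line (sing_in j).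
have incP i j :
    inc (f i) (g j) <-> nth [::] singular j \in nth [::] tits_lines i.
  rewrite gP fP; split=> [/mapP[p]|ji].
    by rewrite mem_filter => /andP[jp p_t] /tits_row_inj->.
  by apply/map_f; rewrite mem_filter ji line_in.
have f_surj x : exists i, f i = x.
  have := F_V1 x; rewrite -rowsE => /mapP[p /(nthP [::])[i]].
  rewrite size_tits_lines => i63 pE xE; exists (Ordinal i63).
  by apply: F_inj; rewrite fP xE -pE.
have f_inj : injective f.
  move=> i j ij; apply: (nth_ord_inj tits_lines_uniq size_tits_lines).
  by apply: tits_row_inj; rewrite ?line_in // -!fP ij.
have g_inj : injective g.
  move=> i j ij; apply: (nth_ord_inj singular_uniq size_singular).
  apply: pencil_inj; rewrite ?sing_in //; apply: eq_in_filter => p.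
  move=> /(nthP [::])[k]; rewrite size_tits_lines => k63 <-.
  by apply/idP/idP=> /(incP (Ordinal k63)); rewrite (ij, esym ij) => /incP.
exists f, g; split; [exact: bijective_inj_surj | apply: bijective_inj_surj =>
  // l |].
  (* Surjectivity on lines: [l] contains some [f i], and the three singular points on the Tits line
     [i] already give three distinct lines on [f i], hence all of them. *)
  have [x [y [z [_ _ _ lE]]]] := card_I3_enum (orderN.1 l).
  have xl : inc x l by apply/lE; constructor 1.
  have [i ix] := f_surj x; rewrite -{}ix in xl.
  have [a [b [c [pE ab ac bc]]]] := tits_line_points (line_in i).
  have [_ p_sing _] := tits_linesP (line_in i).
  have pt s : s \in nth [::] tits_lines i -> exists j, inc (f i) (g j) /\
      nth [::] singular (nat_of_ord j) = s.
    move=> s_p; have /(nthP [::])[j] := p_sing s s_p.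
    rewrite size_singular => j63 sE; exists (Ordinal j63); split=> //.
    by apply/incP; rewrite sE.
  have [a_p b_p c_p] : [/\ a \in nth [::] tits_lines i,
      b \in nth [::] tits_lines i & c \in nth [::] tits_lines i].
    by rewrite pE !inE !eqxx !orbT.
  have [[ja [ia aE]] [jb [ib bE]]] := (pt a a_p, pt b b_p).
  have [jc [ic cE]] := pt c c_p.
  have g_neq (j k : 'I_63) :
      nth [::] singular j <> nth [::] singular k -> g j <> g k.
    by move=> jk /g_inj eq_jk; apply: jk; rewrite eq_jk.
  have [ab' ac' bc'] : [/\ g ja <> g jb, g ja <> g jc & g jb <> g jc].
    by split; apply: g_neq; rewrite ?aE ?bE ?cE.
  by case: (three_lines_through orderN ia ib ic ab' ac' bc' xl) => ->;
    [exists ja | exists jb | exists jc].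
by move=> i j; rewrite incP.
Qed.

End Embedding.

Theorem theorem1p1 (N : geometry) (near_hexagonN : near_hexagon N)
    (orderN : has_order N 2 2)
    (subN : exists (A : set (points N)) (B : set (lines N)),
       isomorphic (subgeometry A B) H21 /\ isometrically_embedded A B) :
  isomorphic N H2D.
Proof.
have [A [B [/isomorphic_sym/(isomorphic_trans H21_model_iso)]]] := subN.
case=> f [g [f_bij g_bij fg]] isometricAB.
(* [inord] serves to index by natural numbers; it is the identity below 21. *)
pose e i := val (f (inord i)).
have dist_e i j : i < 21 -> j < 21 ->
    dist near_hexagonN (e i) (e j) = H21_dist i j.
  (* The isometry reduces distances in N to distances in the subgeometry, and the isomorphism
     reduces these to the flag model. *)
  move=> i21 j21; apply: dist_eq; rewrite -isometricAB (distance_iso f_bij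
    g_bij fg).
  have := H21_model_distance (inord i) (inord j).
  by rewrite -[nat_of_ord (inord i)]/(nat_of_ord (inord i : 'I_21)) !inordK.
have line_e s : s \in H21_lines -> exists l, forall i, i \in s -> inc (e i) l.
  move=> s_line; have /(nthP [::])[j] := s_line.
  rewrite size_H21_lines => j14 sE; exists (val (g (Ordinal j14))) => i i_s.
  have i21 : i < 21.
    have [a [b [c [abc ab bc c21]]]] := H21_lines_sorted s_line.
    by move: i_s; rewrite abc !inE => /or3P[] /eqP->; lia.
  by have [+ _] := fg (inord i) (Ordinal j14); apply; rewrite /= inordK // sE.
apply: isomorphic_trans H2D_model_iso; apply: isomorphic_sym.
exact: model_iso dist_e line_e.
Qed.
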